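(* Assume that ZF has a model. Then the theory $\mathrm{CZF}_{Exp}$ (Constructive Zermelo-Fraenkel set theory CZF with the Subset Collection schema replaced by the Exponentiation axiom) does not prove that the Dedekind reals are a set; that is, $\mathrm{CZF}_{Exp}\nvdash \exists z\,\forall S\,(S\in z\leftrightarrow S \text{ is a Dedekind real})$.
   Context: $\mathrm{CZF}_{Exp}$ is the theory in the language $\{\in\}$, with intuitionistic first-order logic with equality, whose axioms are: Extensionality, Pairing, Union (usual forms); Infinity: $\exists x\forall u[u\in x\leftrightarrow(\emptyset=u\vee\exists v\in x\;u=v+1)]$, where $v+1=v\cup\{v\}$; Set Induction: $\forall x[\forall y\in x\,\phi(y)\rightarrow\phi(x)]\rightarrow\forall x\,\phi(x)$ for all formulas $\phi$; Bounded Separation: $\forall a\exists b\forall x[x\in b\leftrightarrow x\in a\wedge\phi(x)]$ for all bounded formulas $\phi$ (those built from prime formulas using only $\neg,\wedge,\vee,\rightarrow,\forall x\in y,\exists x\in y$); Strong Collection: $\forall a[\forall x\in a\,\exists y\,\phi(x,y)\rightarrow\exists b(\forall x\in a\,\exists y\in b\,\phi(x,y)\wedge\forall y\in b\,\exists x\in a\,\phi(x,y))]$ for all formulas $\phi$; and Exponentiation: for all sets $x,y$ there is a set consisting of exactly the functions with domain $x$ and range contained in $y$. A Dedekind real (left cut) is a set $S\subseteq\mathbb Q$ such that (boundedness) $\exists r\in\mathbb Q\,(r\in S)\wedge\exists r'\in\mathbb Q\,(r'\notin S)$; (openness) $\forall r\in S\,\exists r'\in S\,(r<r')$; (locatedness)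 $\forall r,s\in\mathbb Q\,[r<s\rightarrow r\in S\vee s\notin S]$. *)

(* Defs.v *)
From Stdlib Require Import List.
Import ListNotations.

(** Formulas over the signature {∈, =} in de Bruijn syntax: variables are natural numbers, [All] and [Ex] bind the
    variable [0] of their body.  As the signature has no function symbols,
    terms are variables and every substitution is a renaming. *)

Inductive form : Type :=
| Bot : form
| Mem : nat -> nat -> form
| Eq  : nat -> nat -> form
| And : form -> form -> form
| Or  : form -> form -> form
| Imp : form -> form -> form
| All : form -> form
| Ex  : form -> form.

Declare Scope form_scope.
Delimit Scope form_scope with form.
Bind Scope form_scope with form.
Open Scope form_scope.

Notation "x ∈ y" := (Mem x y) (at level 70, no associativity) : form_scope.
Notation "x ≐ y" := (Eq x y) (at level 70, no associativity) : form_scope.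
Notation "φ ⊓ ψ" := (And φ ψ) (at level 80, right associativity) : form_scope.
Notation "φ ⊔ ψ" := (Or φ ψ) (at level 85, right associativity) : form_scope.
Notation "φ ⇒ ψ" := (Imp φ ψ) (at level 90, right associativity) : form_scope.

Definition Not (φ : form) : form := φ ⇒ Bot.
Definition Iff (φ ψ : form) : form := (φ ⇒ ψ) ⊓ (ψ ⇒ φ).
Notation "φ ⇔ ψ" := (Iff φ ψ) (at level 95, no associativity) : form_scope.

(** Bounded quantifiers: [y] is a variable of the outer context, so the bound
    never is the quantified variable itself. *)
Definition AllIn (y : nat) (φ : form) : form := All (0 ∈ 1 + y ⇒ φ).
Definition ExIn  (y : nat) (φ : form) : form := Ex (0 ∈ 1 + y ⊓ φ).

Definition scons {X : Type} (x : X) (f : nat -> X) (n : nat) : X :=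
  match n with 0 => x | S m => f m end.
Notation "x .: f" := (scons x f) (at level 55, right associativity).

Definition up (r : nat -> nat) : nat -> nat := 0 .: (fun n => S (r n)).

Fixpoint ren (r : nat -> nat) (φ : form) : form :=
  match φ with
  | Bot => Bot
  | Mem x y => Mem (r x) (r y)
  | Eq x y => Eq (r x) (r y)
  | And φ ψ => And (ren r φ) (ren r ψ)
  | Or φ ψ => Or (ren r φ) (ren r ψ)
  | Imp φ ψ => Imp (ren r φ) (ren r ψ)
  | All φ => All (ren (up r) φ)
  | Ex φ => Ex (ren (up r) φ)
  end.

Definition inst (φ : form) (t : nat) : form := ren (t .: (fun n => n)) φ.
Definition shift (φ : form) : form := ren S φ.

(** Every free variable of [φ] is smaller than [fv_bound φ]. *)
Fixpoint fv_bound (φ : form) : nat :=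
  match φ with
  | Bot => 0
  | Mem x y | Eq x y => max (S x) (S y)
  | And φ ψ | Or φ ψ | Imp φ ψ => max (fv_bound φ) (fv_bound ψ)
  | All φ | Ex φ => pred (fv_bound φ)
  end.

Definition universal_closure (φ : form) : form :=
  Nat.iter (fv_bound φ) All φ.

Inductive deriv : list form -> form -> Prop :=
| d_ass Γ φ : In φ Γ -> deriv Γ φ
| d_botE Γ φ : deriv Γ Bot -> deriv Γ φ
| d_andI Γ φ ψ : deriv Γ φ -> deriv Γ ψ -> deriv Γ (φ ⊓ ψ)
| d_andE1 Γ φ ψ : deriv Γ (φ ⊓ ψ) -> deriv Γ φ
| d_andE2 Γ φ ψ : deriv Γ (φ ⊓ ψ) -> deriv Γ ψ
| d_orI1 Γ φ ψ : deriv Γ φ -> deriv Γ (φ ⊔ ψ)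
| d_orI2 Γ φ ψ : deriv Γ ψ -> deriv Γ (φ ⊔ ψ)
| d_orE Γ φ ψ χ :
    deriv Γ (φ ⊔ ψ) -> deriv (φ :: Γ) χ -> deriv (ψ :: Γ) χ -> deriv Γ χ
| d_impI Γ φ ψ : deriv (φ :: Γ) ψ -> deriv Γ (φ ⇒ ψ)
| d_impE Γ φ ψ : deriv Γ (φ ⇒ ψ) -> deriv Γ φ -> deriv Γ ψ
| d_allI Γ φ : deriv (map shift Γ) φ -> deriv Γ (All φ)
| d_allE Γ φ t : deriv Γ (All φ) -> deriv Γ (inst φ t)
| d_exI Γ φ t : deriv Γ (inst φ t) -> deriv Γ (Ex φ)
| d_exE Γ φ ψ :
    deriv Γ (Ex φ) -> deriv (φ :: map shift Γ) (shift ψ) -> deriv Γ ψ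
| d_eqI Γ x : deriv Γ (x ≐ x)
| d_eqE Γ φ x y : deriv Γ (x ≐ y) -> deriv Γ (inst φ x) -> deriv Γ (inst φ y).

Definition theory := form -> Prop.

Definition provable (T : theory) (φ : form) : Prop :=
  exists Γ : list form, (forall ψ, In ψ Γ -> T ψ) /\ deriv Γ φ.

(** From here on, the arguments of the set-theoretic predicates are variables of the ambient context; [k + x] is the
    variable [x] seen from under [k] additional binders. *)

(** x = ∅ *)
Definition is_empty (x : nat) : form := All (Not (0 ∈ 1 + x)).

(** u = v ∪ {v} *)
Definition is_succ (u v : nat) : form :=
  All (0 ∈ 1 + u ⇔ 0 ∈ 1 + v ⊔ 0 ≐ 1 + v).

(** z = {x, y} *)
Definition is_upair (z x y : nat) : form :=
  All (0 ∈ 1 + z ⇔ 0 ≐ 1 + x ⊔ 0 ≐ 1 + y).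

(** p = (x, y) = {{x}, {x, y}} *)
Definition is_pair (p x y : nat) : form :=
  All (0 ∈ 1 + p ⇔ is_upair 0 (1 + x) (1 + x) ⊔ is_upair 0 (1 + x) (1 + y)).

(** (x, y) ∈ f *)
Definition pair_in (x y f : nat) : form := ExIn f (is_pair 0 (1 + x) (1 + y)).

(** ∀u (u ∈ w ↔ ∅ = u ∨ ∃v ∈ w, u = v + 1) *)
Definition is_omega (w : nat) : form :=
  All (0 ∈ 1 + w ⇔ is_empty 0 ⊔ ExIn (1 + w) (is_succ 1 0)).

Definition is_function (f : nat) : form :=
  AllIn f (Ex (Ex (is_pair 2 1 0))) ⊓
  All (All (All (pair_in 2 1 (3 + f) ⇒ pair_in 2 0 (3 + f) ⇒ 1 ≐ 0))).

Definition has_domain (f x : nat) : form :=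
  All (0 ∈ 1 + x ⇔ Ex (pair_in 1 0 (2 + f))).

Definition range_in (f y : nat) : form :=
  All (All (pair_in 1 0 (2 + f) ⇒ 0 ∈ 2 + y)).

(** In the schemata, the variables of [φ] beyond the displayed ones are
    parameters; [ren] keeps variables bound by the axiom but not displayed
    out of [φ]. *)

Definition ax_extensionality : form :=
  All (All (All (0 ∈ 2 ⇔ 0 ∈ 1) ⇒ 1 ≐ 0)).

Definition ax_pairing : form :=
  All (All (Ex (is_upair 0 2 1))).

(** ∀a ∃b ∀x (x ∈ b ↔ ∃y ∈ a, x ∈ y) *)
Definition ax_union : form :=
  All (Ex (All (0 ∈ 1 ⇔ ExIn 2 (1 ∈ 0)))).

Definition ax_infinity : form := Ex (is_omega 0).

(** φ(x) with x = 0 *)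
Definition ax_set_induction (φ : form) : form :=
  All (AllIn 0 (ren (0 .: (fun n => 2 + n)) φ) ⇒ φ) ⇒ All φ.

(** φ(x, a) with x = 0, a = 1;  ∀a ∃b ∀x (x ∈ b ↔ x ∈ a ∧ φ) *)
Definition ax_separation (φ : form) : form :=
  All (Ex (All (0 ∈ 1 ⇔ 0 ∈ 2 ⊓ ren (0 .: (fun n => 2 + n)) φ))).

(** φ(x, y, a) with y = 0, x = 1, a = 2 *)
Definition ax_strong_collection (φ : form) : form :=
  All (AllIn 0 (Ex φ) ⇒
       Ex (AllIn 1 (ExIn 1 (ren (0 .: 1 .: (fun n => 3 + n)) φ)) ⊓
           AllIn 0 (ExIn 2 (ren (1 .: 0 .: (fun n => 3 + n)) φ)))).

(** ∀x ∀y ∃z ∀f (f ∈ z ↔ f is a function, dom f = x, ran f ⊆ y) *)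
Definition ax_exponentiation : form :=
  All (All (Ex (All
    (0 ∈ 1 ⇔ is_function 0 ⊓ has_domain 0 3 ⊓ range_in 0 2)))).

Inductive bounded : form -> Prop :=
| b_bot : bounded Bot
| b_mem x y : bounded (x ∈ y)
| b_eq x y : bounded (x ≐ y)
| b_and φ ψ : bounded φ -> bounded ψ -> bounded (φ ⊓ ψ)
| b_or φ ψ : bounded φ -> bounded ψ -> bounded (φ ⊔ ψ)
| b_imp φ ψ : bounded φ -> bounded ψ -> bounded (φ ⇒ ψ)
| b_all y φ : bounded φ -> bounded (AllIn y φ)
| b_ex y φ : bounded φ -> bounded (ExIn y φ).

Inductive CZF_Exp : theory :=
| czf_ext : CZF_Exp ax_extensionality
| czf_pair : CZF_Exp ax_pairing
| czf_union : CZF_Exp ax_union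
| czf_inf : CZF_Exp ax_infinity
| czf_ind φ : CZF_Exp (universal_closure (ax_set_induction φ))
| czf_sep φ : bounded φ -> CZF_Exp (universal_closure (ax_separation φ))
| czf_coll φ : CZF_Exp (universal_closure (ax_strong_collection φ))
| czf_exp : CZF_Exp ax_exponentiation.

(** ∀a ∃b ∀x (x ∈ b ↔ x ⊆ a) *)
Definition ax_powerset : form :=
  All (Ex (All (0 ∈ 1 ⇔ AllIn 0 (0 ∈ 3)))).

(** ∃x (∅ ∈ x ∧ ∀u ∈ x, u + 1 ∈ x) *)
Definition ax_infinity_inductive : form :=
  Ex (ExIn 0 (is_empty 0) ⊓ AllIn 0 (ExIn 1 (is_succ 0 1))).

(** ∀x (x ≠ ∅ → ∃y ∈ x, y ∩ x = ∅) *)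
Definition ax_foundation : form :=
  All (Ex (0 ∈ 1) ⇒ ExIn 0 (AllIn 0 (Not (0 ∈ 2)))).

(** φ(x, y, a) with y = 0, x = 1, a = 2;
    ∀a [∀x ∈ a ∀y y' (φ(x,y) ∧ φ(x,y') → y = y') →
        ∃b ∀y (y ∈ b ↔ ∃x ∈ a, φ(x,y))] *)
Definition ax_replacement (φ : form) : form :=
  All (AllIn 0 (All (All
         (ren (1 .: 2 .: (fun n => 3 + n)) φ ⇒
          ren (0 .: 2 .: (fun n => 3 + n)) φ ⇒ 1 ≐ 0))
       ) ⇒
       Ex (All (0 ∈ 1 ⇔
                ExIn 2 (ren (1 .: 0 .: (fun n => 3 + n)) φ)))).

Inductive ZF : theory :=
| zf_ext : ZF ax_extensionality
| zf_pair : ZF ax_pairing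
| zf_union : ZF ax_union
| zf_power : ZF ax_powerset
| zf_inf : ZF ax_infinity_inductive
| zf_found : ZF ax_foundation
| zf_sep φ : ZF (universal_closure (ax_separation φ))
| zf_repl φ : ZF (universal_closure (ax_replacement φ)).

Fixpoint sat {D : Type} (E : D -> D -> Prop) (e : nat -> D) (φ : form) : Prop :=
  match φ with
  | Bot => False
  | Mem x y => E (e x) (e y)
  | Eq x y => e x = e y
  | And φ ψ => sat E e φ /\ sat E e ψ
  | Or φ ψ => sat E e φ \/ sat E e ψ
  | Imp φ ψ => sat E e φ -> sat E e ψ
  | All φ => forall d : D, sat E (d .: e) φ
  | Ex φ => exists d : D, sat E (d .: e) φ
  end.

Definition is_model {D : Type} (E : D -> D -> Prop) (T : theory) : Prop :=
  forall φ, T φ -> forall e : nat -> D, sat E e φ.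

(** Structures are nonempty; on an empty [D] there is no assignment [e], and
    [is_model] would hold vacuously. *)
Definition has_model (T : theory) : Prop :=
  exists (D : Type) (E : D -> D -> Prop), inhabited D /\ is_model E T.

Definition is_nat (x : nat) : form := Ex (is_omega 0 ⊓ 1 + x ∈ 0).

(** [y] is the value at [n] of a function [f] on ω such that [f(0) = z] and
    [R p (f(m+1)) (f(m))] for all m ∈ ω. *)
Definition iterate (R : nat -> nat -> nat -> form) (p z n y : nat) : form :=
  Ex (Ex (* ω = 1, f = 0 *)
    (is_omega 1 ⊓ is_function 0 ⊓ has_domain 0 1 ⊓
     Ex (is_empty 0 ⊓ pair_in 0 (3 + z) 1) ⊓
     AllIn 1 (All (* m = 1, v = 0 *)
       (pair_in 1 0 2 ⇒
        Ex (Ex (* m' = 1, v' = 0 *)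
          (is_succ 1 3 ⊓ R (6 + p) 0 2 ⊓ pair_in 1 0 4)))) ⊓
     pair_in (2 + n) (2 + y) 0)).

(** c = a + b: the [b]-th iterate of successor at [a]; the parameter of
    [iterate] is not used. *)
Definition is_sum (a b c : nat) : form :=
  iterate (fun _ v' v => is_succ v' v) a a b c.

(** c = a · b: the [b]-th iterate of adding [a] at 0 *)
Definition is_prod (a b c : nat) : form :=
  Ex (is_empty 0 ⊓
      iterate (fun p v' v => is_sum v p v') (1 + a) 0 (1 + b) (1 + c)).

(** k = a · b + c · d *)
Definition is_sum_prod (a b c d k : nat) : form :=
  Ex (Ex (is_prod (2 + a) (2 + b) 1 ⊓ is_prod (2 + c) (2 + d) 0 ⊓
          is_sum 1 0 (2 + k))).

(** A fraction is a triple ((a, b), c) of natural numbers with c ≠ 0, which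
    stands for (a - b) / c; a rational is an equivalence class of fractions. *)

Definition is_fraction (t a b c : nat) : form :=
  is_nat a ⊓ is_nat b ⊓ is_nat c ⊓ Not (is_empty c) ⊓
  Ex (is_pair 0 (1 + a) (1 + b) ⊓ is_pair (1 + t) 0 (1 + c)).

(** [P k l] holds for k = a·c' + b'·c and l = a'·c + b·c', where
    t = ((a, b), c) and t' = ((a', b'), c'). *)
Definition compare_fractions (P : form) (t t' : nat) : form :=
  Ex (Ex (Ex (Ex (Ex (Ex (* a, b, c, a', b', c' = 5, 4, 3, 2, 1, 0 *)
    (is_fraction (6 + t) 5 4 3 ⊓ is_fraction (6 + t') 2 1 0 ⊓
     Ex (Ex (* k = 1, l = 0 *)
       (is_sum_prod 7 2 3 5 1 ⊓ is_sum_prod 4 5 6 2 0 ⊓ P)))))))).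

Definition fraction_eq (t t' : nat) : form := compare_fractions (1 ≐ 0) t t'.
Definition fraction_lt (t t' : nat) : form := compare_fractions (1 ∈ 0) t t'.

Definition is_rational (q : nat) : form :=
  Ex (Ex (Ex (Ex (is_fraction 3 2 1 0))) ⊓
      All (0 ∈ 2 + q ⇔ fraction_eq 0 1)).

Definition rational_lt (q r : nat) : form :=
  ExIn q (ExIn (1 + r) (fraction_lt 1 0)).

Definition is_dedekind_real (s : nat) : form :=
  AllIn s (is_rational 0) ⊓
  (Ex (is_rational 0 ⊓ 0 ∈ 1 + s) ⊓ Ex (is_rational 0 ⊓ Not (0 ∈ 1 + s))) ⊓
  AllIn s (ExIn (1 + s) (rational_lt 1 0)) ⊓
  All (All (is_rational 1 ⇒ is_rational 0 ⇒ rational_lt 1 0 ⇒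
            1 ∈ 2 + s ⊔ Not (0 ∈ 2 + s))).

Definition dedekind_reals_are_a_set : form :=
  Ex (All (0 ∈ 1 ⇔ is_dedekind_real 0)).

(* Main.v *)
(** Topological forcing over the real line, with settling. The ground model
    consists of the trees modulo bisimulation. A name is a Heyting-valued set
    over the line that carries, for every real [r], a ground set into which it
    may settle at [r]. An implication or universal statement is forced near
    [x] only if it also remains forced when, at any [y] near [x], its
    parameters are replaced by their settled values and forcing starts anew
    at an arbitrary real.

    Witnesses of existential statements settle to ground witnesses. Hence
    bounded formulas are absolute for ground parameters, which gives Bounded
    Separation, and Strong Collection also holds at the settled stage. A
    function between ground sets is locally constant, and so ground because
    the line is locally connected: settled sets have an exponential, which is
    ground. But the generic cut [{q | q < y}] varies with the real [y], so it
    is not ground. A set of all Dedekind reals would settle to a ground set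
    that still contains the generic cut, making this cut locally constant. *)

From Stdlib Require Import ZArith Reals Lra Lia List Arith Classical ClassicalEpsilon FunctionalExtensionality PropExtensionality.
Require Import Defs.

(** * Ground sets *)

(** Without the restart in [box], this would be ordinary forcing over the line, where the cuts do
    form a set. The restart destroys that set: a set is replaced by a ground set, while the
    quantifier in its defining property still ranges over all names, [generic] among them. Every set
    that an axiom provides has to survive this test. Exponentiation does, because a function has a
    decided value at each real: taking the value [v] at [u] and taking another one are disjoint open
    conditions that cover an interval, and connectedness fixes the value. A cut escapes this
    argument, since at [y = q] neither membership of [q] nor its negation is forced, and locatedness
    only offers two overlapping alternatives. The restart takes place at every real, not only near
    the settling point, so that forcing with ground parameters does not depend on the point and can
    be compared with truth in the ground model. The component [h] of a name exists because the
    settled value of a set may need elements that no forced element nearby has as its value, such as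
    further functions between two settled sets. *)

Inductive tree : Type := Node (A : Type) (f : A -> tree).

Fixpoint bisim (s t : tree) : Prop :=
  match s, t with
  | Node A f, Node B g =>
      (forall a, exists b, bisim (f a) (g b)) /\
      (forall b, exists a, bisim (f a) (g b))
  end.

Lemma bisim_refl s : bisim s s.
Proof. induction s as [A f IH]; simpl; split; intros a; exists a; apply IH. Qed.

Lemma bisim_sym s t : bisim s t -> bisim t s.
Proof.
  revert t; induction s as [A f IH]; intros [B g]; simpl; intros [H1 H2]; split.
  - intros b; destruct (H2 b) as [a Ha]; exists a; auto.
  - intros a; destruct (H1 a) as [b Hb]; exists b; auto.
Qed.

Lemma bisim_trans s t u : bisim s t -> bisim t u -> bisim s u.
Proof.
  revert t u; induction s as [A f IH]; intros [B g] [C h]; simpl.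
  intros [H1 H2] [H3 H4]; split.
  - intros a; destruct (H1 a) as [b Hb]; destruct (H3 b) as [c Hc]; exists c; eauto.
  - intros c; destruct (H4 c) as [b Hb]; destruct (H2 b) as [a Ha]; exists a; eauto.
Qed.

(** Quotienting by bisimulation makes extensional equality Leibniz equality,
    so that [sat] applies to ground sets. *)
Definition gset : Type := {P : tree -> Prop | exists t, P = bisim t}.

Definition cls (t : tree) : gset := exist _ (bisim t) (ex_intro _ t eq_refl).

Definition repr (q : gset) : tree :=
  proj1_sig (constructive_indefinite_description _ (proj2_sig q)).

Lemma cls_eq s t : bisim s t -> cls s = cls t.
Proof.
  intros H. unfold cls.
  assert (E : bisim s = bisim t).
  { extensionality u. apply propositional_extensionality. split; intros K.
    - eapply bisim_trans; [apply bisim_sym, H | exact K].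
    - eapply bisim_trans; eauto. }
  apply eq_sig_hprop; [intros; apply proof_irrelevance | exact E].
Qed.

Lemma cls_repr q : cls (repr q) = q.
Proof.
  apply eq_sig_hprop; [intros; apply proof_irrelevance |].
  unfold repr. simpl.
  destruct (constructive_indefinite_description _ (proj2_sig q)) as [t Ht].
  simpl. now rewrite Ht.
Qed.

Lemma cls_inj s t : cls s = cls t -> bisim s t.
Proof.
  intros H. apply (f_equal (@proj1_sig _ _)) in H. simpl in H.
  rewrite H. apply bisim_refl.
Qed.

(** The indices of the chosen representative turn a ground set into a small index type, over which
    subsets, images and names can be formed. Distinct indices may give the same element. *)
Definition idx (q : gset) : Type := match repr q with Node A _ => A end.

Definition el (q : gset) : idx q -> gset :=
  match repr q as t return match t with Node A _ => A end -> gset with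
  | Node A f => fun a => cls (f a)
  end.

Definition mem (u q : gset) : Prop := exists i, el q i = u.

Definition sup (A : Type) (f : A -> gset) : gset :=
  cls (Node A (fun a => repr (f a))).
Arguments sup {A} f.

Lemma mem_cls u A f : mem u (cls (Node A f)) <-> exists a, u = cls (f a).
Proof.
  unfold mem, el, idx.
  assert (H : bisim (repr (cls (Node A f))) (Node A f)) by apply cls_inj, cls_repr.
  destruct (repr (cls (Node A f))) as [B g]. destruct H as [H1 H2]. split.
  - intros [b <-]. destruct (H1 b) as [a Ha]. exists a. now apply cls_eq.
  - intros [a ->]. destruct (H2 a) as [b Hb]. exists b. now apply cls_eq.
Qed.

Lemma mem_sup u A (f : A -> gset) : mem u (sup f) <-> exists a, u = f a.
Proof.
  unfold sup. rewrite mem_cls. split; intros [a Ha]; exists a; now rewrite cls_repr in *.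
Qed.

Lemma gset_ext a b : (forall u, mem u a <-> mem u b) -> a = b.
Proof.
  rewrite <- (cls_repr a), <- (cls_repr b).
  destruct (repr a) as [A f], (repr b) as [B g]. intros H. apply cls_eq. split.
  - intros x. assert (K : mem (cls (f x)) (cls (Node B g))).
    { apply H, mem_cls. now exists x. }
    apply mem_cls in K as [y Hy]. exists y. now apply cls_inj.
  - intros y. assert (K : mem (cls (g y)) (cls (Node A f))).
    { apply H, mem_cls. now exists y. }
    apply mem_cls in K as [x Hx]. exists x. apply cls_inj. congruence.
Qed.

Lemma mem_wf : well_founded mem.
Proof.
  intros q. rewrite <- (cls_repr q). induction (repr q) as [A f IH].
  constructor. intros u Hu. apply mem_cls in Hu as [a ->]. apply IH.
Qed.

Definition gempty : gset := sup (fun x : False => match x with end).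

Lemma mem_gempty u : ~ mem u gempty.
Proof. intros H. apply mem_sup in H as [[] _]. Qed.

Definition gupair (a b : gset) : gset := sup (fun i : bool => if i then a else b).

Lemma mem_gupair u a b : mem u (gupair a b) <-> u = a \/ u = b.
Proof.
  unfold gupair. rewrite mem_sup. split.
  - intros [[|] ->]; auto.
  - intros [-> | ->]; [now exists true | now exists false].
Qed.

Definition gsep (q : gset) (P : gset -> Prop) : gset :=
  sup (fun i : {i : idx q | P (el q i)} => el q (proj1_sig i)).

Lemma mem_gsep u q P : mem u (gsep q P) <-> mem u q /\ P u.
Proof.
  unfold gsep. rewrite mem_sup. split.
  - intros [[i Hi] ->]. simpl. split; [now exists i | exact Hi].
  - intros [[i <-] H]. now exists (exist _ i H).
Qed.

Definition gimage (q : gset) (F : gset -> gset) : gset := sup (fun i : idx q => F (el q i)).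

Lemma mem_gimage v q F : mem v (gimage q F) <-> exists u, mem u q /\ v = F u.
Proof.
  unfold gimage. rewrite mem_sup. split.
  - intros [i ->]. exists (el q i). split; [now exists i | reflexivity].
  - intros (u & [i <-] & ->). now exists i.
Qed.

Definition gunion (q : gset) : gset :=
  sup (fun i : {i : idx q & idx (el q i)} => el (el q (projT1 i)) (projT2 i)).

Lemma mem_gunion u q : mem u (gunion q) <-> exists v, mem v q /\ mem u v.
Proof.
  unfold gunion. rewrite mem_sup. split.
  - intros [[i j] ->]. simpl. exists (el q i). split; [now exists i | now exists j].
  - intros (v & [i <-] & [j <-]). now exists (existT _ i j).
Qed.

Definition gcup (a b : gset) : gset := gunion (gupair a b).

Lemma mem_gcup u a b : mem u (gcup a b) <-> mem u a \/ mem u b.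
Proof.
  unfold gcup. rewrite mem_gunion. split.
  - intros (v & Hv & Hu). apply mem_gupair in Hv as [-> | ->]; auto.
  - intros [H | H]; [exists a | exists b]; split; auto; apply mem_gupair; auto.
Qed.

(** Predicates on [idx q] serve as indices: as [Prop] is small, the power set stays within the
    universe of the trees. *)
Definition gpow (q : gset) : gset :=
  sup (fun P : idx q -> Prop => sup (fun i : {i | P i} => el q (proj1_sig i))).

Lemma mem_gpow u q : mem u (gpow q) <-> forall v, mem v u -> mem v q.
Proof.
  unfold gpow. rewrite mem_sup. split.
  - intros [P ->] v Hv. apply mem_sup in Hv as [[i Hi] ->]. now exists i.
  - intros H. exists (fun i => mem (el q i) u). apply gset_ext. intros v.
    rewrite mem_sup. split.
    + intros Hv. destruct (H v Hv) as [i <-]. now exists (exist _ i Hv).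
    + now intros [[i Hi] ->].
Qed.

Definition gpair (a b : gset) : gset := gupair (gupair a a) (gupair a b).

Lemma gupair_inj a b c : gupair a b = gupair a c -> b = c.
Proof.
  intros H.
  assert (Hb : mem b (gupair a c)) by (rewrite <- H; apply mem_gupair; auto).
  assert (Hc : mem c (gupair a b)) by (rewrite H; apply mem_gupair; auto).
  apply mem_gupair in Hb, Hc. intuition congruence.
Qed.

Lemma gupair_singleton a b c : gupair a a = gupair b c -> a = b /\ a = c.
Proof.
  intros H.
  assert (Hb : mem b (gupair a a)) by (rewrite H; apply mem_gupair; auto).
  assert (Hc : mem c (gupair a a)) by (rewrite H; apply mem_gupair; auto).
  apply mem_gupair in Hb, Hc. intuition congruence.
Qed.

Lemma gpair_inj a b c d : gpair a b = gpair c d -> a = c /\ b = d.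
Proof.
  intros H.
  assert (a = c).
  { assert (K : mem (gupair a a) (gpair c d)) by (rewrite <- H; apply mem_gupair; auto).
    apply mem_gupair in K as [K | K]; apply gupair_singleton in K; intuition. }
  subst c. split; [reflexivity |]. unfold gpair in H.
  apply gupair_inj in H. now apply gupair_inj in H.
Qed.

Definition gprod (a b : gset) : gset :=
  sup (fun i : idx a * idx b => gpair (el a (fst i)) (el b (snd i))).

Lemma mem_gprod p a b :
  mem p (gprod a b) <-> exists u v, mem u a /\ mem v b /\ p = gpair u v.
Proof.
  unfold gprod. rewrite mem_sup. split.
  - intros [[i j] ->]. exists (el a i), (el b j). repeat split; [now exists i | now exists j].
  - intros (u & v & [i <-] & [j <-] & ->). now exists (i, j).
Qed.

Definition gsucc (a : gset) : gset := gcup a (gupair a a).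

Lemma mem_gsucc u a : mem u (gsucc a) <-> mem u a \/ u = a.
Proof. unfold gsucc. rewrite mem_gcup, mem_gupair. intuition. Qed.

Fixpoint num (n : nat) : gset := match n with 0 => gempty | S n => gsucc (num n) end.

Lemma mem_num u n : mem u (num n) <-> exists m, m < n /\ u = num m.
Proof.
  induction n; simpl.
  - split; [intros H; now apply mem_gempty in H | intros (m & Hm & _); lia].
  - rewrite mem_gsucc, IHn. split.
    + intros [(m & Hm & ->) | ->]; [exists m; auto with arith | exists n; auto with arith].
    + intros (m & Hm & ->). destruct (Nat.eq_dec m n) as [-> | ]; auto.
      left. exists m. split; auto; lia.
Qed.

Lemma mem_irrefl a : ~ mem a a.
Proof.
  induction (mem_wf a) as [a _ IH]. intros H. exact (IH a H H).
Qed.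

Lemma num_inj m n : num m = num n -> m = n.
Proof.
  intros H. destruct (lt_eq_lt_dec m n) as [[L | E] | L]; auto; exfalso.
  - apply (mem_irrefl (num n)). rewrite <- H at 1. apply mem_num. eauto.
  - apply (mem_irrefl (num m)). rewrite H at 1. apply mem_num. eauto.
Qed.

Definition gomega : gset := sup num.

Lemma mem_gomega u : mem u gomega <-> exists n, u = num n.
Proof. apply mem_sup. Qed.

(** * Names and forcing *)

(** The interior operator of the line. Working with interiors of arbitrary predicates avoids
    carrying open sets and proofs of openness around. *)
Definition near (P : R -> Prop) (x : R) : Prop :=
  exists d, (0 < d)%R /\ forall y, (Rabs (y - x) < d)%R -> P y.

Lemma near_all (P : R -> Prop) x : (forall y, P y) -> near P x.
Proof. intros H. exists 1%R. split; [lra | auto]. Qed.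

Lemma near_self P x : near P x -> P x.
Proof. intros (d & Hd & H). apply H. rewrite Rminus_diag, Rabs_R0. exact Hd. Qed.

Lemma near_mono (P Q : R -> Prop) x : (forall y, P y -> Q y) -> near P x -> near Q x.
Proof. intros H (d & Hd & K). exists d. auto. Qed.

Lemma near_and P Q x : near P x -> near Q x -> near (fun y => P y /\ Q y) x.
Proof.
  intros (d & Hd & H) (d' & Hd' & H'). exists (Rmin d d'). split.
  - now apply Rmin_glb_lt.
  - intros y Hy. split; [apply H | apply H'];
      (eapply Rlt_le_trans; [exact Hy |]); [apply Rmin_l | apply Rmin_r].
Qed.

Lemma near_near P x : near P x -> near (near P) x.
Proof.
  intros (d & Hd & H). exists d. split; [exact Hd |]. intros y Hy.
  exists (d - Rabs (y - x))%R. split; [lra |]. intros z Hz. apply H.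
  replace (z - x)%R with ((z - y) + (y - x))%R by ring.
  pose proof (Rabs_triang (z - y) (y - x)). lra.
Qed.

Lemma near_and3 P Q S x :
  near P x -> near Q x -> near S x -> near (fun y => P y /\ Q y /\ S y) x.
Proof. intros. apply near_and; [assumption | now apply near_and]. Qed.

(** In [Nm A f U h], [f a] is an element on the interior of [U a] (so that [U a]
    need not be open), and [h r] lists the elements of the value settled at [r]
    that do not come from the [f a]. *)
Inductive name : Type :=
  Nm (A : Type) (f : A -> name) (U : A -> R -> Prop) (h : R -> gset).

(** Elements present around [r] are always counted, so [h] can only enlarge the settled value. This
    is what makes forced membership survive settling, see [fmem_ev]. *)
Fixpoint ev (s : name) (r : R) : gset :=
  match s with
  | Nm A f U h =>
      gcup (sup (fun a : {a | near (U a) r} => ev (f (proj1_sig a)) r)) (h r)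
  end.

Lemma mem_ev u A f U h r :
  mem u (ev (Nm A f U h) r) <->
  (exists a, near (U a) r /\ u = ev (f a) r) \/ mem u (h r).
Proof.
  cbn [ev]. rewrite mem_gcup, mem_sup. apply or_iff_compat_r. split.
  - intros [[a Ha] ->]. eauto.
  - intros (a & Ha & ->). now exists (exist _ a Ha).
Qed.

(** The canonical name of a ground set: its elements are present everywhere and [h] adds nothing, so
    it settles to the set itself at every real. Recursion follows [mem_wf], because the quotient
    [gset] has no structural recursion. *)
Definition check : gset -> name :=
  Fix mem_wf (fun _ => name) (fun q rec =>
    Nm (idx q) (fun i => rec (el q i) (ex_intro _ i eq_refl)) (fun _ _ => True) (fun _ => gempty)).

Lemma check_eq q :
  check q = Nm (idx q) (fun i => check (el q i)) (fun _ _ => True) (fun _ => gempty).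
Proof.
  unfold check at 1. rewrite Fix_eq; [reflexivity |].
  intros a f g H. f_equal. extensionality i. apply H.
Qed.

Lemma ev_check q r : ev (check q) r = q.
Proof.
  induction (mem_wf q) as [q _ IH]. apply gset_ext. intros u.
  rewrite check_eq, mem_ev. split.
  - intros [(i & _ & ->) | H]; [| now apply mem_gempty in H].
    rewrite IH by now exists i. now exists i.
  - intros [i <-]. left. exists i. split; [now apply near_all |].
    symmetry. apply IH. now exists i.
Qed.

(** Mutual inclusion on a neighbourhood does not see the elements contributed by [h]; the third
    clause compares them through the settled values, so that equality survives settling. *)
Fixpoint feq (s t : name) (x : R) : Prop :=
  match s, t with
  | Nm A f U h, Nm B g W k =>
      near (fun y =>
        (forall a, near (U a) y -> exists b, near (W b) y /\ feq (f a) (g b) y) /\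
        (forall b, near (W b) y -> exists a, near (U a) y /\ feq (f a) (g b) y) /\
        ev (Nm A f U h) y = ev (Nm B g W k) y) x
  end.

Definition fmem (s t : name) (x : R) : Prop :=
  match t with Nm B g W k => exists b, near (W b) x /\ feq s (g b) x end.

Lemma feq_Nm A f U h B g W k x :
  feq (Nm A f U h) (Nm B g W k) x =
  near (fun y =>
    (forall a, near (U a) y -> exists b, near (W b) y /\ feq (f a) (g b) y) /\
    (forall b, near (W b) y -> exists a, near (U a) y /\ feq (f a) (g b) y) /\
    ev (Nm A f U h) y = ev (Nm B g W k) y) x.
Proof. reflexivity. Qed.

Lemma feq_refl s x : feq s s x.
Proof.
  revert x. induction s as [A f IH U h]. intros x. rewrite feq_Nm. apply near_all. intros y.
  split; [| split]; [intros a Ha; exists a; auto | intros a Ha; exists a; auto | reflexivity].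
Qed.

Lemma feq_sym s t x : feq s t x -> feq t s x.
Proof.
  revert t x. induction s as [A f IH U h]. intros [B g W k] x. rewrite !feq_Nm.
  apply near_mono. intros y (H1 & H2 & H3). split; [| split]; auto.
  - intros b Hb. destruct (H2 b Hb) as (a & Ha & H). eauto.
  - intros a Ha. destruct (H1 a Ha) as (b & Hb & H). eauto.
Qed.

Lemma feq_trans s t u x : feq s t x -> feq t u x -> feq s u x.
Proof.
  revert t u x. induction s as [A f IH U h]. intros [B g W k] [C l X m] x H K.
  rewrite feq_Nm in *. generalize (near_and _ _ _ H K). apply near_mono.
  intros y ((H1 & H2 & H3) & K1 & K2 & K3). split; [| split].
  - intros a Ha. destruct (H1 a Ha) as (b & Hb & E).
    destruct (K1 b Hb) as (c & Hc & E'). eauto.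
  - intros c Hc. destruct (K2 c Hc) as (b & Hb & E').
    destruct (H2 b Hb) as (a & Ha & E). eauto.
  - congruence.
Qed.

Lemma feq_near s t x : feq s t x -> near (feq s t) x.
Proof. destruct s, t. rewrite feq_Nm. apply near_near. Qed.

Lemma feq_ev s t x : feq s t x -> ev s x = ev t x.
Proof. destruct s, t. rewrite feq_Nm. intros H. apply near_self in H. apply H. Qed.

Lemma fmem_near s t x : fmem s t x -> near (fmem s t) x.
Proof.
  destruct t as [B g W k]. intros (b & Hb & H).
  generalize (near_and _ _ _ (near_near _ _ Hb) (feq_near _ _ _ H)).
  apply near_mono. intros y []. exists b. auto.
Qed.

Lemma fmem_ev s t x : fmem s t x -> mem (ev s x) (ev t x).
Proof.
  destruct t as [B g W k]. intros (b & Hb & H). apply mem_ev.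
  left. exists b. split; [exact Hb | now apply feq_ev].
Qed.

Lemma fmem_congl s s' t x : feq s s' x -> fmem s t x -> fmem s' t x.
Proof.
  destruct t as [B g W k]. intros E (b & Hb & H). exists b. split; auto.
  eapply feq_trans; [apply feq_sym, E | exact H].
Qed.

Lemma fmem_congr s t t' x : feq t t' x -> fmem s t x -> fmem s t' x.
Proof.
  destruct t as [B g W k], t' as [C l X m]. intros E (b & Hb & H).
  rewrite feq_Nm in E. apply near_self in E as (E1 & _). destruct (E1 b Hb) as (c & Hc & K).
  exists c. split; auto. eapply feq_trans; eauto.
Qed.

Lemma fmem_check s q x : fmem s (check q) x <-> exists u, mem u q /\ feq s (check u) x.
Proof.
  rewrite check_eq. simpl. split.
  - intros (i & _ & H). exists (el q i). split; [now exists i | exact H].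
  - intros (u & [i <-] & H). exists i. split; [now apply near_all | exact H].
Qed.

Lemma feq_check a b x : feq (check a) (check b) x <-> a = b.
Proof.
  split; [| intros ->; apply feq_refl].
  intros H. apply feq_ev in H. now rewrite !ev_check in H.
Qed.

Lemma fmem_check2 a b x : fmem (check a) (check b) x <-> mem a b.
Proof.
  rewrite fmem_check. split.
  - intros (u & Hu & H). apply feq_check in H. now subst.
  - intros H. exists a. split; [exact H | apply feq_refl].
Qed.

Lemma feq_ext s t x :
  near (fun y => (forall u, fmem u s y <-> fmem u t y) /\ ev s y = ev t y) x -> feq s t x.
Proof.
  destruct s as [A f U h], t as [B g W k]. rewrite feq_Nm. apply near_mono. intros y [H E].
  split; [| split]; auto.
  - intros a Ha. apply (H (f a)). exists a. split; [exact Ha | apply feq_refl].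
  - intros b Hb. destruct (proj2 (H (g b))) as (a & Ha & K).
    + exists b. split; [exact Hb | apply feq_refl].
    + exists a. split; [exact Ha | now apply feq_sym].
Qed.

(** * The forcing relation and its persistence *)

Definition settle (e : nat -> name) (y : R) : nat -> name := fun n => check (ev (e n) y).

(** The second conjunct restarts at every real [z], not only near [y]. *)
Definition box (P : (nat -> name) -> R -> Prop) (e : nat -> name) (x : R) : Prop :=
  near (fun y => P e y /\ forall z, P (settle e y) z) x.

(** The reals that force a formula form an open set ([forces_near]). Unions of open sets are open,
    so [Or] and [Ex] can be read pointwise without open covers; [Imp] and [All] need the interior
    taken by [box]. *)
Fixpoint forces (φ : form) (e : nat -> name) (x : R) : Prop :=
  match φ with
  | Bot => False
  | Mem i j => fmem (e i) (e j) x
  | Eq i j => feq (e i) (e j) x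
  | And φ ψ => forces φ e x /\ forces ψ e x
  | Or φ ψ => forces φ e x \/ forces ψ e x
  | Imp φ ψ => box (fun e x => forces φ e x -> forces ψ e x) e x
  | All φ => box (fun e x => forall s, forces φ (s .: e) x) e x
  | Ex φ => exists s, forces φ (s .: e) x
  end.

Lemma scons_comp {X Y} (f : X -> Y) a e : (fun n => f ((a .: e) n)) = (f a .: (fun n => f (e n))).
Proof. extensionality n. now destruct n. Qed.

Lemma settle_scons s e y : settle (s .: e) y = (check (ev s y) .: settle e y).
Proof. apply (scons_comp (fun s => check (ev s y))). Qed.

Lemma settle_settle e y z : settle (settle e y) z = settle e y.
Proof. extensionality n. unfold settle. now rewrite ev_check. Qed.

Lemma settle_check q y : settle (fun n => check (q n)) y = (fun n => check (q n)).
Proof. extensionality n. unfold settle. now rewrite ev_check. Qed.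

Definition persistent (P : (nat -> name) -> R -> Prop) : Prop :=
  forall e x, P e x -> box P e x.

Lemma box_self P e x : box P e x -> P e x.
Proof. intros H. now apply near_self in H. Qed.

Lemma box_settled P e x : box P e x -> forall z, P (settle e x) z.
Proof. intros H. now apply near_self in H. Qed.

Lemma box_mono (P Q : (nat -> name) -> R -> Prop) e x :
  (forall e y, P e y -> Q e y) -> box P e x -> box Q e x.
Proof. intros H. apply near_mono. intros y []. split; auto. Qed.

Lemma box_and P Q e x : box P e x -> box Q e x -> box (fun e y => P e y /\ Q e y) e x.
Proof.
  intros H K. generalize (near_and _ _ _ H K). apply near_mono.
  intros y ((H1 & H2) & K1 & K2). auto.
Qed.

Lemma box_all (P : (nat -> name) -> R -> Prop) e x : (forall e y, P e y) -> box P e x.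
Proof. intros H. apply near_all. auto. Qed.

(** Both the interior and settling are idempotent: once the parameters are settled, settling them
    again at another real changes nothing. *)
Lemma box_box P : persistent (box P).
Proof.
  intros e x H. apply near_near in H. revert H. apply near_mono.
  intros y H. split; [exact H |]. intros z. apply near_all. intros w.
  apply near_self in H as [_ H]. split; [auto |]. intros v. rewrite settle_settle. auto.
Qed.

Lemma box_intro (P Q : (nat -> name) -> R -> Prop) e x :
  persistent P -> P e x -> (forall e y, P e y -> Q e y) -> box Q e x.
Proof. intros HP H HQ. eapply box_mono; [exact HQ | now apply HP]. Qed.

Lemma persistent_and P Q : persistent P -> persistent Q -> persistent (fun e x => P e x /\ Q e x).
Proof. intros HP HQ e x [H K]. apply box_and; auto. Qed.

(** Atomic formulas pass to the settled stage by [fmem_ev] and [feq_ev], implications and universal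
    formulas by [box_box]. For [Ex] the witness settles together with the parameters. *)
Lemma forces_persistent φ : persistent (forces φ).
Proof.
  induction φ; intros e x H.
  - destruct H.
  - generalize (near_and _ _ _ (fmem_near _ _ _ H) (fmem_near _ _ _ H)). apply near_mono.
    intros y [K _]. split; [exact K |]. intros z. apply fmem_check2, fmem_ev, K.
  - generalize (feq_near _ _ _ H). apply near_mono.
    intros y K. split; [exact K |]. intros z. apply feq_check, feq_ev, K.
  - destruct H. apply (persistent_and (forces φ1) (forces φ2)); simpl; auto.
  - destruct H; [apply (box_mono (forces φ1)) | apply (box_mono (forces φ2))]; simpl; auto.
  - now apply box_box.
  - now apply box_box.
  - destruct H as [s H]. apply IHφ in H. revert H. apply near_mono.
    intros y [K L]. split; [now exists s |]. intros z. exists (check (ev s y)).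
    rewrite <- settle_scons. apply L.
Qed.

Lemma forces_near φ e x : forces φ e x -> near (forces φ e) x.
Proof. intros H. apply forces_persistent in H. revert H. apply near_mono. tauto. Qed.

Lemma forces_settled φ e x z : forces φ e x -> forces φ (settle e x) z.
Proof. intros H. apply forces_persistent in H. now apply box_settled with (z := z) in H. Qed.

Lemma forces_ren φ r e x : forces (ren r φ) e x <-> forces φ (fun n => e (r n)) x.
Proof.
  revert r e x. induction φ; intros r e x; simpl; try tauto.
  - rewrite IHφ1, IHφ2. tauto.
  - rewrite IHφ1, IHφ2. tauto.
  - unfold box. split; apply near_mono; intros y [H1 H2]; (split; [| intros z; specialize (H2 z)]);
      rewrite IHφ1, IHφ2 in *; auto.
  - assert (E : forall (s : name) (e : nat -> name), (fun n => (s .: e) (up r n)) = (s .: (fun n => e (r n)))).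
    { intros. extensionality n. now destruct n. }
    unfold box. split; apply near_mono; intros y [H1 H2]; split.
    + intros s. specialize (H1 s). rewrite IHφ, E in H1. exact H1.
    + intros z s. specialize (H2 z s). rewrite IHφ, E in H2. exact H2.
    + intros s. rewrite IHφ, E. apply H1.
    + intros z s. rewrite IHφ, E. apply (H2 z s).
  - assert (E : forall (s : name) (e : nat -> name), (fun n => (s .: e) (up r n)) = (s .: (fun n => e (r n)))).
    { intros. extensionality n. now destruct n. }
    split; intros [s H]; exists s; rewrite IHφ, E in *; auto.
Qed.

(** One neighbourhood must serve all variables, since infinitely many equalities could hold on
    shrinking neighbourhoods only. Equal names settle to the same ground set, so the settled half of
    each [box] does not change at all. *)
Lemma forces_cong φ e e' x :
  near (fun y => forall n, feq (e n) (e' n) y) x -> forces φ e x -> forces φ e' x.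
Proof.
  assert (Esym : forall (e e' : nat -> name) x, near (fun y => forall n, feq (e n) (e' n) y) x ->
                 near (fun y => forall n, feq (e' n) (e n) y) x).
  { intros ? ? ?. apply near_mono. intros y H n. apply feq_sym, H. }
  assert (Es : forall (e e' : nat -> name) x, near (fun y => forall n, feq (e n) (e' n) y) x ->
                 settle e x = settle e' x).
  { intros ? ? ? H. extensionality n. unfold settle. f_equal. apply feq_ev.
    apply near_self in H. apply H. }
  assert (Ec : forall s (e e' : nat -> name) x, near (fun y => forall n, feq (e n) (e' n) y) x ->
                 near (fun y => forall n, feq ((s .: e) n) ((s .: e') n) y) x).
  { intros ? ? ? ?. apply near_mono. intros y H [|n]; [apply feq_refl | apply H]. }
  revert e e' x. induction φ; simpl; intros e e' x E H.
  - exact H.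
  - apply near_self in E. eapply fmem_congr; [apply E | eapply fmem_congl; [apply E | exact H]].
  - apply near_self in E. eapply feq_trans; [apply feq_sym, E |].
    eapply feq_trans; [exact H | apply E].
  - destruct H. eauto.
  - destruct H; eauto.
  - generalize (near_and _ _ _ (near_near _ _ E) H). apply near_mono.
    intros y (K & H1 & H2). rewrite (Es _ _ _ K) in H2. split; [| exact H2]. eauto.
  - generalize (near_and _ _ _ (near_near _ _ E) H). apply near_mono.
    intros y (K & H1 & H2). rewrite (Es _ _ _ K) in H2. split; [| exact H2]. eauto.
  - destruct H as [s H]. exists s. eauto.
Qed.

Lemma forces_cong0 φ s t e x : feq s t x -> forces φ (s .: e) x -> forces φ (t .: e) x.
Proof.
  intros E. apply forces_cong. generalize (feq_near _ _ _ E). apply near_mono.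
  intros y H [|n]; [exact H | apply feq_refl].
Qed.

Lemma forces_inst φ t e x : forces (inst φ t) e x <-> forces φ (e t .: e) x.
Proof.
  unfold inst. rewrite forces_ren.
  replace (fun n => e ((t .: (fun n0 => n0)) n)) with (e t .: e); [tauto |].
  extensionality n. now destruct n.
Qed.

Lemma forces_shift φ s e x : forces (shift φ) (s .: e) x <-> forces φ e x.
Proof. unfold shift. now rewrite forces_ren. Qed.

(** * Soundness of intuitionistic logic *)

Definition ctx_forced (Γ : list form) (e : nat -> name) (x : R) : Prop :=
  forall ψ, In ψ Γ -> forces ψ e x.

Lemma ctx_forced_cons φ Γ e x : forces φ e x -> ctx_forced Γ e x -> ctx_forced (φ :: Γ) e x.
Proof. intros H K ψ [<- | Hin]; auto. Qed.

Lemma ctx_forced_shift Γ s e x : ctx_forced Γ e x -> ctx_forced (map shift Γ) (s .: e) x.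
Proof. intros H ψ Hin. apply in_map_iff in Hin as (χ & <- & Hin). apply forces_shift; auto. Qed.

Lemma ctx_forced_persistent Γ : persistent (ctx_forced Γ).
Proof.
  intros e x. induction Γ as [| φ Γ IH]; intros H.
  - apply box_all. intros ? ? ? [].
  - eapply box_mono; [| apply box_and; [apply (forces_persistent φ) | apply IH]].
    + intros e' y [H1 H2]. now apply ctx_forced_cons.
    + apply H. now left.
    + intros ψ Hψ. apply H. now right.
Qed.

(** The rules [d_impI] and [d_allI] have to enter a [box], which is possible because a forced
    context is persistent as a whole. The rules [d_impE] and [d_allE] read the [box] at the point
    itself. *)
Theorem soundness Γ φ : deriv Γ φ -> forall e x, ctx_forced Γ e x -> forces φ e x.
Proof.
  induction 1; intros e z Hc; simpl in *.
  - auto.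
  - destruct (IHderiv e z Hc).
  - auto.
  - now apply IHderiv.
  - now apply IHderiv.
  - auto.
  - auto.
  - destruct (IHderiv1 e z Hc); auto using ctx_forced_cons.
  - apply (box_intro (ctx_forced Γ)); auto using ctx_forced_persistent, ctx_forced_cons.
  - specialize (IHderiv1 e z Hc). apply box_self in IHderiv1. auto.
  - apply (box_intro (ctx_forced Γ)); auto using ctx_forced_persistent, ctx_forced_shift.
  - apply forces_inst. specialize (IHderiv e z Hc). apply box_self in IHderiv. apply IHderiv.
  - exists (e t). apply forces_inst. auto.
  - destruct (IHderiv1 e z Hc) as [s Hs]. apply (forces_shift ψ s).
    apply IHderiv2. apply ctx_forced_cons; auto using ctx_forced_shift.
  - apply feq_refl.
  - apply forces_inst. specialize (IHderiv1 e z Hc). specialize (IHderiv2 e z Hc).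
    apply forces_inst in IHderiv2. eapply forces_cong0; eauto.
Qed.

(** * Semantics of the set-theoretic predicates *)

(** Nested implications and universal quantifiers collapse to a single [box],
    because [box] is idempotent. *)
Definition boxed (φ : form) (P : (nat -> name) -> R -> Prop) : Prop :=
  forall e x, forces φ e x <-> box P e x.

Lemma box_iff (P Q : (nat -> name) -> R -> Prop) e x :
  (forall e y, P e y <-> Q e y) -> box P e x <-> box Q e x.
Proof. intros H. split; apply box_mono; intros; now apply H. Qed.

Lemma boxed_iff φ (P Q : (nat -> name) -> R -> Prop) :
  (forall e y, P e y <-> Q e y) -> boxed φ P -> boxed φ Q.
Proof. intros H HP e x. rewrite (HP e x). now apply box_iff. Qed.

Lemma boxed_forces φ : boxed φ (forces φ).
Proof. intros e x. split; [apply forces_persistent | apply box_self]. Qed.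

(** After settling at [y], the fixed name [s] becomes [check (ev s y)], which is one of the
    instances that the hypothesis covers. *)
Lemma box_scons P e x : box (fun e y => forall s, P (s .: e) y) e x -> forall s, box P (s .: e) x.
Proof.
  intros H s. revert H. apply near_mono. intros y [H1 H2]. split; [auto |].
  intros z. rewrite settle_scons. apply H2.
Qed.

Lemma boxed_all φ P : boxed φ P -> boxed (All φ) (fun e y => forall s, P (s .: e) y).
Proof.
  intros HP e x. split.
  - apply box_mono. intros e' y H s. apply box_self. apply HP, H.
  - intros H. apply (box_intro (box (fun e y => forall s, P (s .: e) y))); auto using box_box.
    intros e' y K s. apply HP. now apply box_scons.
Qed.

Lemma boxed_imp φ ψ P : boxed ψ P -> boxed (φ ⇒ ψ) (fun e y => forces φ e y -> P e y).
Proof.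
  intros HP e x. split.
  - apply box_mono. intros e' y H K. apply box_self. apply HP, H, K.
  - intros H. apply (box_intro (box (fun e y => forces φ e y -> P e y))); auto using box_box.
    intros e' y K F. apply HP. apply (box_intro (fun e y => box (fun e y => forces φ e y -> P e y) e y /\ forces φ e y)).
    + apply persistent_and; auto using box_box, forces_persistent.
    + auto.
    + intros e1 y1 [H1 H2]. apply box_self in H1. auto.
Qed.

Lemma boxed_and φ ψ P Q :
  boxed φ P -> boxed ψ Q -> boxed (φ ⊓ ψ) (fun e y => P e y /\ Q e y).
Proof.
  intros HP HQ e x. simpl. rewrite (HP e x), (HQ e x). split.
  - intros []. now apply box_and.
  - intros H. split; revert H; apply box_mono; tauto.
Qed.

Lemma boxed_all_iff φ ψ :
  boxed (All (φ ⇔ ψ)) (fun e y => forall s, forces φ (s .: e) y <-> forces ψ (s .: e) y).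
Proof. apply (boxed_all (φ ⇔ ψ) (fun e y => forces φ e y <-> forces ψ e y)).
  apply (boxed_and (φ ⇒ ψ) (ψ ⇒ φ)); apply boxed_imp, boxed_forces. Qed.

Lemma boxed_all_imp φ ψ :
  boxed (All (φ ⇒ ψ)) (fun e y => forall s, forces φ (s .: e) y -> forces ψ (s .: e) y).
Proof. apply (boxed_all (φ ⇒ ψ) (fun e y => forces φ e y -> forces ψ e y)).
  apply boxed_imp, boxed_forces. Qed.

Definition valid (φ : form) : Prop := forall e x, forces φ e x.

Lemma valid_all φ : valid φ -> valid (All φ).
Proof. intros H e x. apply box_all. intros e' y s. apply H. Qed.

Lemma valid_imp φ ψ : (forall e x, forces φ e x -> forces ψ e x) -> valid (φ ⇒ ψ).
Proof. intros H e x. apply box_all. exact H. Qed.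

Lemma valid_universal_closure φ : valid φ -> valid (universal_closure φ).
Proof.
  unfold universal_closure. induction (fv_bound φ); simpl; auto using valid_all.
Qed.

(** Equal forced elements do not suffice for [feq]. The settled half of the hypothesis, tested on
    canonical names, supplies equality of the settled values. *)
Lemma forces_extensionality i j e x :
  forces (All (0 ∈ 1 + i ⇔ 0 ∈ 1 + j)) e x -> feq (e i) (e j) x.
Proof.
  intros H. apply boxed_all_iff in H. apply feq_ext. revert H. apply near_mono.
  intros y [H1 H2]. split; [exact H1 |]. apply gset_ext. intros u.
  specialize (H2 y (check u)). simpl in H2. unfold settle in H2.
  now rewrite !fmem_check2 in H2.
Qed.

(** The common pattern behind defined terms and set existence axioms. Besides having the right
    elements near [x], [N] must settle to a ground set that has the right elements at every real,
    among all names, once the parameters are settled. The Dedekind reals fail this second demand. *)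
Lemma forces_comprehension φ i N e x :
  near (fun y => (forall s, forces φ (s .: e) y <-> fmem s N y) /\
                 forall z s, forces φ (s .: settle e y) z <-> fmem s (check (ev N y)) z) x ->
  forces (All (0 ∈ 1 + i ⇔ φ)) e x <-> feq (e i) N x.
Proof.
  intros HN. rewrite (boxed_all_iff (0 ∈ 1 + i) φ e x). split; intros H.
  - apply feq_ext. generalize (near_and _ _ _ HN H). apply near_mono.
    intros y ((H1 & H2) & K1 & K2). split.
    + intros s. rewrite <- H1. apply K1.
    + apply gset_ext. intros u. specialize (H2 y (check u)). specialize (K2 y (check u)).
      rewrite <- K2 in H2. simpl in H2. unfold settle in H2. now rewrite !fmem_check2 in H2.
  - generalize (near_and _ _ _ HN (feq_near _ _ _ H)). apply near_mono.
    intros y ((H1 & H2) & K). split.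
    + intros s. rewrite H1. simpl. split; apply fmem_congr; auto using feq_sym.
    + intros z s. rewrite H2. apply feq_ev in K. simpl. unfold settle. now rewrite K.
Qed.

(** * Names for pairs and successors, and the set of natural numbers *)

Definition nupair (a b : name) : name :=
  Nm bool (fun i => if i then a else b) (fun _ _ => True) (fun _ => gempty).

Lemma fmem_nupair s a b x : fmem s (nupair a b) x <-> feq s a x \/ feq s b x.
Proof.
  simpl. split.
  - intros [[|] [_ H]]; auto.
  - intros [H | H]; [exists true | exists false]; (split; [now apply near_all | exact H]).
Qed.

Lemma ev_nupair a b y : ev (nupair a b) y = gupair (ev a y) (ev b y).
Proof.
  apply gset_ext. intros u. unfold nupair. rewrite mem_ev, mem_gupair. split.
  - intros [([|] & _ & ->) | H]; auto. now apply mem_gempty in H.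
  - intros [-> | ->]; left; [exists true | exists false]; (split; [now apply near_all | reflexivity]).
Qed.

Lemma fmem_check_gupair s a b x :
  fmem s (check (gupair a b)) x <-> feq s (check a) x \/ feq s (check b) x.
Proof.
  rewrite fmem_check. split.
  - intros (u & Hu & H). apply mem_gupair in Hu as [-> | ->]; auto.
  - intros [H | H]; eexists; (split; [apply mem_gupair | exact H]); auto.
Qed.

Lemma feq_nupair a b a' b' x :
  feq a a' x -> feq b b' x -> feq (nupair a b) (nupair a' b') x.
Proof.
  intros H K. apply feq_ext. generalize (near_and _ _ _ (feq_near _ _ _ H) (feq_near _ _ _ K)).
  apply near_mono. intros y [Ha Hb]. split.
  - intros u. rewrite !fmem_nupair.
    split; (intros [E | E]; [left | right]); eapply feq_trans; eauto using feq_sym.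
  - rewrite !ev_nupair. f_equal; now apply feq_ev.
Qed.

Lemma feq_nupair_check a b x : feq (nupair (check a) (check b)) (check (gupair a b)) x.
Proof.
  apply feq_ext, near_all. intros y. split.
  - intros u. now rewrite fmem_nupair, fmem_check_gupair.
  - now rewrite ev_nupair, !ev_check.
Qed.

Definition npair (a b : name) : name := nupair (nupair a a) (nupair a b).

Lemma ev_npair a b y : ev (npair a b) y = gpair (ev a y) (ev b y).
Proof. unfold npair. now rewrite !ev_nupair. Qed.

Lemma feq_npair a b a' b' x :
  feq a a' x -> feq b b' x -> feq (npair a b) (npair a' b') x.
Proof. intros. now repeat apply feq_nupair. Qed.

Lemma feq_npair_check a b x : feq (npair (check a) (check b)) (check (gpair a b)) x.
Proof.
  eapply feq_trans; [| apply feq_nupair_check]. apply feq_nupair; apply feq_nupair_check.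
Qed.

(** The index [None] stands for [a] itself, present everywhere. Since [h] is inherited, the settled
    value gains exactly the value of [a]. *)
Definition nsucc (a : name) : name :=
  match a with Nm A f U h =>
    Nm (option A) (fun i => match i with Some i => f i | None => a end)
      (fun i => match i with Some i => U i | None => fun _ => True end) h
  end.

Lemma fmem_nsucc s a x : fmem s (nsucc a) x <-> fmem s a x \/ feq s a x.
Proof.
  destruct a as [A f U h]. simpl. split.
  - intros [[i|] [Hi H]]; [left; exists i; auto | now right].
  - intros [[i [Hi H]] | H]; [now exists (Some i) | exists None].
    split; [now apply near_all | exact H].
Qed.

Lemma ev_nsucc a y : ev (nsucc a) y = gsucc (ev a y).
Proof.
  apply gset_ext. intros u. rewrite mem_gsucc. destruct a as [A f U h] eqn:Ea.
  unfold nsucc. rewrite !mem_ev. split.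
  - intros [([i|] & Hi & ->) | H]; [| now right |]; left; eauto.
  - intros [[(i & Hi & ->) | H] | ->]; [left | now right | left].
    + now exists (Some i).
    + exists None. split; [now apply near_all | reflexivity].
Qed.

Lemma fmem_check_gsucc s a x :
  fmem s (check (gsucc a)) x <-> fmem s (check a) x \/ feq s (check a) x.
Proof.
  rewrite !fmem_check. split.
  - intros (u & Hu & H). apply mem_gsucc in Hu as [Hu | ->]; eauto.
  - intros [(u & Hu & H) | H]; eexists; (split; [apply mem_gsucc | exact H]); auto.
Qed.

Lemma feq_nsucc a b x : feq a b x -> feq (nsucc a) (nsucc b) x.
Proof.
  intros H. apply feq_ext. generalize (feq_near _ _ _ H). apply near_mono. intros y K. split.
  - intros u. rewrite !fmem_nsucc. split; (intros [E | E]; [left | right]);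
      eauto using fmem_congr, feq_sym, feq_trans.
  - rewrite !ev_nsucc. f_equal. now apply feq_ev.
Qed.

Lemma feq_nsucc_check a x : feq (nsucc (check a)) (check (gsucc a)) x.
Proof.
  apply feq_ext, near_all. intros y. split.
  - intros u. now rewrite fmem_nsucc, fmem_check_gsucc.
  - now rewrite ev_nsucc, !ev_check.
Qed.

Lemma forces_is_empty i e x : forces (is_empty i) e x <-> feq (e i) (check gempty) x.
Proof.
  unfold is_empty. rewrite (boxed_all_imp (0 ∈ 1 + i) Bot e x). split; intros H.
  - apply feq_ext. revert H. apply near_mono. intros y [H1 H2]. split.
    + intros u. split; intros K; [now apply H1 in K |].
      apply fmem_check in K as (v & Hv & _). now apply mem_gempty in Hv.
    + rewrite ev_check. apply gset_ext. intros u. split; intros K; exfalso.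
      * apply (H2 y (check u)). simpl. unfold settle. now apply fmem_check2.
      * now apply mem_gempty in K.
  - generalize (feq_near _ _ _ H). apply near_mono. intros y K. split.
    + intros s L. simpl in L. apply (fmem_congr _ _ _ _ K) in L.
      apply fmem_check in L as (v & Hv & _). now apply mem_gempty in Hv.
    + intros z s. simpl. unfold settle. rewrite (feq_ev _ _ _ K), ev_check. intros L.
      apply fmem_check in L as (v & Hv & _). now apply mem_gempty in Hv.
Qed.

Lemma forces_is_succ u v e x : forces (is_succ u v) e x <-> feq (e u) (nsucc (e v)) x.
Proof.
  apply forces_comprehension, near_all. intros y. split; intros; simpl.
  - now rewrite fmem_nsucc.
  - now rewrite ev_nsucc, fmem_check_gsucc.
Qed.

Lemma forces_is_upair z a b e x : forces (is_upair z a b) e x <-> feq (e z) (nupair (e a) (e b)) x.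
Proof.
  apply forces_comprehension, near_all. intros y. split; intros.
  - rewrite fmem_nupair. reflexivity.
  - rewrite ev_nupair, fmem_check_gupair. reflexivity.
Qed.

Lemma forces_is_pair p a b e x : forces (is_pair p a b) e x <-> feq (e p) (npair (e a) (e b)) x.
Proof.
  apply forces_comprehension, near_all. intros y. split; intros.
  - cbn [forces]. rewrite !forces_is_upair. unfold npair. now rewrite fmem_nupair.
  - cbn [forces]. rewrite !forces_is_upair, ev_npair. unfold gpair. rewrite fmem_check_gupair.
    simpl. unfold settle.
    split; (intros [H | H]; [left | right]); (eapply feq_trans; [exact H |]);
      first [apply feq_nupair_check | apply feq_sym, feq_nupair_check].
Qed.

Lemma forces_pair_in a b f e x : forces (pair_in a b f) e x <-> fmem (npair (e a) (e b)) (e f) x.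
Proof.
  unfold pair_in, ExIn. cbn [forces]. split.
  - intros (s & Hs & H). rewrite forces_is_pair in H. exact (fmem_congl _ _ _ _ H Hs).
  - intros H. exists (npair (e a) (e b)). split; [exact H |]. rewrite forces_is_pair. apply feq_refl.
Qed.

Lemma boxed_is_omega w :
  boxed (is_omega w) (fun e y => forall s, fmem s (e w) y <->
    feq s (check gempty) y \/ exists t, fmem t (e w) y /\ feq s (nsucc t) y).
Proof.
  eapply boxed_iff; [| apply boxed_all_iff]. intros e y.
  assert (E : forall s, forces (is_empty 0 ⊔ ExIn (1 + w) (is_succ 1 0)) (s .: e) y <->
    feq s (check gempty) y \/ exists t, fmem t (e w) y /\ feq s (nsucc t) y).
  { intros s. unfold ExIn. cbn [forces]. rewrite forces_is_empty. apply or_iff_compat_l.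
    split; intros (t & H & K); exists t; rewrite forces_is_succ in *; auto. }
  split; intros H s; specialize (H s); rewrite E in *; exact H.
Qed.

(** Structural induction on the name [s] takes the place of induction on sets: if [s] is forced to
    be the successor of [t], then [t] is forced to be an element of [s], hence equal to one of its
    immediate subnames, to which the induction hypothesis applies. *)
Lemma omega_fmem (w s : name) (x : R) :
  (forall s, fmem s w x <->
     feq s (check gempty) x \/ exists t, fmem t w x /\ feq s (nsucc t) x) ->
  fmem s w x <-> fmem s (check gomega) x.
Proof.
  intros H. rewrite fmem_check. split.
  - induction s as [A f IH U h]. intros Hs. destruct (proj1 (H _) Hs) as [E | (t & Ht & E)].
    + exists (num 0). split; [apply mem_gomega; now exists 0 | exact E].
    + assert (K : fmem t (Nm A f U h) x).
      { apply (fmem_congr _ (nsucc t)); [now apply feq_sym | apply fmem_nsucc; right; apply feq_refl]. }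
      destruct K as (a & _ & K). destruct (IH a) as (u & Hu & Hf).
      { eapply fmem_congl; eauto. }
      apply mem_gomega in Hu as [n ->]. exists (num (S n)).
      split; [apply mem_gomega; now exists (S n) |].
      eapply feq_trans; [exact E |]. eapply feq_trans; [| apply feq_nsucc_check].
      apply feq_nsucc. eapply feq_trans; eauto.
  - intros (u & Hu & E). apply mem_gomega in Hu as [n ->].
    revert s E. induction n as [| n IH]; intros s E; apply H.
    + now left.
    + right. exists (check (num n)). split; [apply IH, feq_refl |].
      eapply feq_trans; [exact E | apply feq_sym, feq_nsucc_check].
Qed.

Lemma check_gomega_unfold s x :
  fmem s (check gomega) x <->
  feq s (check gempty) x \/ exists t, fmem t (check gomega) x /\ feq s (nsucc t) x.
Proof.
  rewrite fmem_check. split.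
  - intros (u & Hu & E). apply mem_gomega in Hu as [[|n] ->]; [now left | right].
    exists (check (num n)). split; [apply fmem_check2, mem_gomega; now exists n |].
    eapply feq_trans; [exact E | apply feq_sym, feq_nsucc_check].
  - intros [E | (t & Ht & E)].
    + exists (num 0). split; [apply mem_gomega; now exists 0 | exact E].
    + apply fmem_check in Ht as (u & Hu & K). apply mem_gomega in Hu as [n ->].
      exists (num (S n)). split; [apply mem_gomega; now exists (S n) |].
      eapply feq_trans; [exact E |]. eapply feq_trans; [apply feq_nsucc, K | apply feq_nsucc_check].
Qed.

Lemma forces_is_omega w e x : forces (is_omega w) e x <-> feq (e w) (check gomega) x.
Proof.
  rewrite (boxed_is_omega w e x). split; intros H.
  - apply feq_ext. revert H. apply near_mono. intros y [H1 H2]. split.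
    + intros s. now apply omega_fmem.
    + rewrite ev_check. apply gset_ext. intros u.
      pose proof (omega_fmem _ (check u) y (H2 y)) as H. unfold settle in H.
      now rewrite !fmem_check2 in H.
  - apply feq_near in H. revert H. apply near_mono. intros y H.
    assert (K : forall w z, feq w (check gomega) z -> forall s, fmem s w z <->
      feq s (check gempty) z \/ exists t, fmem t w z /\ feq s (nsucc t) z).
    { intros w' z E s.
      assert (F : forall s, fmem s w' z <-> fmem s (check gomega) z).
      { split; apply fmem_congr; auto using feq_sym. }
      rewrite F, check_gomega_unfold. apply or_iff_compat_l.
      split; intros (t & Ht & Et); exists t; (split; [now apply F | exact Et]). }
    split; [now apply K |]. intros z. apply K. unfold settle.
    rewrite (feq_ev _ _ _ H), ev_check. apply feq_refl.
Qed.

Lemma forces_is_nat a e x :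
  forces (is_nat a) e x <-> exists n, feq (e a) (check (num n)) x.
Proof.
  unfold is_nat. cbn [forces]. split.
  - intros (w & Hw & Ha). rewrite forces_is_omega in Hw.
    apply (fmem_congr _ _ _ _ Hw) in Ha. apply fmem_check in Ha as (u & Hu & E).
    apply mem_gomega in Hu as [n ->]. now exists n.
  - intros [n E]. exists (check gomega). rewrite forces_is_omega. split; [apply feq_refl |].
    apply fmem_check. exists (num n). split; [apply mem_gomega; now exists n | exact E].
Qed.

(** * The same predicates in the ground model *)

Lemma sat_is_empty e i : sat mem e (is_empty i) <-> e i = gempty.
Proof.
  split.
  - intros H. apply gset_ext. intros u. split; intros K.
    + destruct (H u K).
    + now apply mem_gempty in K.
  - intros H u K. change (mem u (e i)) in K. rewrite H in K. now apply mem_gempty in K.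
Qed.

Lemma sat_comprehension e i φ c :
  (forall u, sat mem (u .: e) φ <-> mem u c) ->
  sat mem e (All (0 ∈ 1 + i ⇔ φ)) <-> e i = c.
Proof.
  intros Hc. split.
  - intros H. apply gset_ext. intros u. rewrite <- Hc. split; apply (H u).
  - intros E u. split; intros K; [apply Hc; rewrite <- E | apply Hc in K; rewrite <- E in K]; exact K.
Qed.

Lemma sat_is_succ e u v : sat mem e (is_succ u v) <-> e u = gsucc (e v).
Proof. apply sat_comprehension. intros w. now rewrite mem_gsucc. Qed.

Lemma sat_is_upair e z a b : sat mem e (is_upair z a b) <-> e z = gupair (e a) (e b).
Proof. apply sat_comprehension. intros w. now rewrite mem_gupair. Qed.

Lemma sat_is_pair e p a b : sat mem e (is_pair p a b) <-> e p = gpair (e a) (e b).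
Proof.
  apply sat_comprehension. intros w. cbn [sat]. rewrite !sat_is_upair.
  unfold gpair. now rewrite mem_gupair.
Qed.

Lemma sat_pair_in e a b f : sat mem e (pair_in a b f) <-> mem (gpair (e a) (e b)) (e f).
Proof.
  unfold pair_in, ExIn. cbn [sat]. split.
  - intros (p & Hp & H). rewrite sat_is_pair in H. simpl in H. subst p. exact Hp.
  - intros H. exists (gpair (e a) (e b)). now rewrite sat_is_pair.
Qed.

Lemma sat_is_omega e w : sat mem e (is_omega w) <-> e w = gomega.
Proof.
  assert (K : forall u, sat mem (u .: e) (is_empty 0 ⊔ ExIn (1 + w) (is_succ 1 0)) <->
    u = num 0 \/ exists v, mem v (e w) /\ u = gsucc v).
  { intros u. unfold ExIn. cbn [sat]. rewrite sat_is_empty. apply or_iff_compat_l.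
    split; intros (v & Hv & E); exists v; rewrite sat_is_succ in *; auto. }
  split.
  - intros H.
    assert (H' : forall u, mem u (e w) <-> u = num 0 \/ exists v, mem v (e w) /\ u = gsucc v).
    { intros u. rewrite <- K. split; apply (H u). }
    apply gset_ext. intros u. rewrite mem_gomega. split.
    + induction (mem_wf u) as [u _ IH]. intros Hu.
      apply H' in Hu as [-> | (v & Hv & ->)]; [now exists 0 |].
      destruct (IH v) as [n ->]; [apply mem_gsucc; auto | exact Hv | now exists (S n)].
    + intros [n ->]. induction n as [|n IH]; apply H'; [now left | right; eauto].
  - intros E. assert (H' : forall u, mem u (e w) <-> u = num 0 \/ exists v, mem v (e w) /\ u = gsucc v).
    { rewrite E. intros u. rewrite mem_gomega. split.
      - intros [[|n] ->]; [now left | right]. exists (num n). split; [apply mem_gomega; eauto | reflexivity].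
      - intros [-> | (v & Hv & ->)]; [now exists 0 |]. apply mem_gomega in Hv as [n ->]. now exists (S n). }
    intros u. specialize (H' u). rewrite <- K in H'. exact H'.
Qed.

Lemma sat_is_nat e a : sat mem e (is_nat a) <-> exists n, e a = num n.
Proof.
  unfold is_nat. cbn [sat]. rewrite <- mem_gomega. split.
  - intros (w & Hw & H). rewrite sat_is_omega in Hw. simpl in Hw. now subst w.
  - intros H. exists gomega. now rewrite sat_is_omega.
Qed.

(** * Absoluteness for ground parameters *)

Definition absolute (φ : form) : Prop :=
  forall q z, forces φ (fun n => check (q n)) z <-> sat mem q φ.

(** Canonical names are fixed by settling, so the neighbourhood drops out and only the restart at
    every real remains. *)
Lemma box_check P q x : box P (fun n => check (q n)) x <-> forall z, P (fun n => check (q n)) z.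
Proof.
  split.
  - intros H z. apply box_settled with (z := z) in H. now rewrite settle_check in H.
  - intros H. apply near_all. intros y. split; [apply H |]. now rewrite settle_check.
Qed.

Lemma check_scons u q : (check u .: (fun n => check (q n))) = (fun n => check ((u .: q) n)).
Proof. symmetry. apply (scons_comp check). Qed.

Lemma absolute_cons φ u q z : absolute φ ->
  forces φ (check u .: (fun n => check (q n))) z <-> sat mem (u .: q) φ.
Proof. intros H. rewrite check_scons. apply H. Qed.

Lemma absolute_bot : absolute Bot.
Proof. intros q z. reflexivity. Qed.

Lemma absolute_mem i j : absolute (i ∈ j).
Proof. intros q z. apply fmem_check2. Qed.

Lemma absolute_eq i j : absolute (i ≐ j).
Proof. intros q z. apply feq_check. Qed.

Lemma absolute_and φ ψ : absolute φ -> absolute ψ -> absolute (φ ⊓ ψ).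
Proof. intros H K q z. cbn [forces sat]. now rewrite (H q z), (K q z). Qed.

Lemma absolute_or φ ψ : absolute φ -> absolute ψ -> absolute (φ ⊔ ψ).
Proof. intros H K q z. cbn [forces sat]. now rewrite (H q z), (K q z). Qed.

Lemma absolute_imp φ ψ : absolute φ -> absolute ψ -> absolute (φ ⇒ ψ).
Proof.
  intros H K q z. cbn [forces sat]. rewrite box_check. split.
  - intros F G. apply (K q z), (F z), H, G.
  - intros F w G. apply K, F, (H q w), G.
Qed.

(** Unbounded existential quantifiers are absolute because a witness settles
    to a ground set. *)
Lemma absolute_ex φ : absolute φ -> absolute (Ex φ).
Proof.
  intros H q z. split.
  - intros [s Hs]. apply (forces_settled _ _ _ z) in Hs.
    rewrite settle_scons, settle_check in Hs. exists (ev s z).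
    now apply absolute_cons in Hs.
  - intros [u Hu]. exists (check u). now apply absolute_cons.
Qed.

Definition grounded (s : name) (x : R) : Prop := exists c, feq s (check c) x.

(** A forced universal quantifier ranges over all names, its ground counterpart over ground sets
    only. A guard confines the relevant instances to locally ground names, which makes the two
    ranges agree. *)
Definition guard (φ : form) : Prop :=
  forall q s z, forces φ (s .: (fun n => check (q n))) z -> grounded s z.

Lemma absolute_all_imp φ ψ : absolute φ -> absolute ψ -> guard φ -> absolute (All (φ ⇒ ψ)).
Proof.
  intros H K G q z. rewrite (boxed_all_imp φ ψ _ z), box_check. split.
  - intros F u Hu. apply (absolute_cons ψ u q z K), F, (absolute_cons φ u q z H), Hu.
  - intros F w s Hs. destruct (G _ _ _ Hs) as [u E].
    apply (forces_cong0 _ _ _ _ _ (feq_sym _ _ _ E)), (absolute_cons ψ u q w K), F.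
    apply (absolute_cons φ u q w H), (forces_cong0 _ _ _ _ _ E), Hs.
Qed.

Lemma absolute_all_iff φ ψ :
  absolute φ -> absolute ψ -> guard φ -> guard ψ -> absolute (All (φ ⇔ ψ)).
Proof.
  intros H K G G' q z. pose proof (absolute_all_imp φ ψ H K G q z) as L1.
  pose proof (absolute_all_imp ψ φ K H G' q z) as L2.
  transitivity (forces (All (φ ⇒ ψ)) (fun n => check (q n)) z /\
                forces (All (ψ ⇒ φ)) (fun n => check (q n)) z).
  - rewrite (boxed_all_iff φ ψ _ z), (boxed_all_imp φ ψ _ z), (boxed_all_imp ψ φ _ z), !box_check.
    split; [intros F; split; intros w s; apply F | intros [F F'] w s; split; [apply F | apply F']].
  - rewrite L1, L2. cbn [sat]. split; [intros [F F'] u; split; [exact (F u) | exact (F' u)] | intros F; split; intros u; apply (F u)].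
Qed.

Lemma guard_mem i : guard (0 ∈ S i).
Proof. intros q s z H. apply fmem_check in H as (u & _ & E). now exists u. Qed.

Lemma absolute_all_in i φ : absolute φ -> absolute (AllIn i φ).
Proof. intros H. apply absolute_all_imp; auto using absolute_mem, guard_mem. Qed.

Lemma absolute_ex_in i φ : absolute φ -> absolute (ExIn i φ).
Proof. intros H. apply absolute_ex, absolute_and; auto using absolute_mem. Qed.

Lemma absolute_bounded φ : bounded φ -> absolute φ.
Proof.
  induction 1; auto using absolute_bot, absolute_mem, absolute_eq, absolute_and,
    absolute_or, absolute_imp, absolute_all_in, absolute_ex_in.
Qed.

Lemma absolute_is_empty i : absolute (is_empty i).
Proof. intros q z. now rewrite forces_is_empty, sat_is_empty, feq_check. Qed.

Lemma absolute_is_succ u v : absolute (is_succ u v).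
Proof.
  intros q z. rewrite forces_is_succ, sat_is_succ, <- (feq_check _ _ z).
  split; intros H; eapply feq_trans; eauto using feq_sym, feq_nsucc_check.
Qed.

Lemma absolute_is_pair p a b : absolute (is_pair p a b).
Proof.
  intros q z. rewrite forces_is_pair, sat_is_pair, <- (feq_check _ _ z).
  split; intros H; eapply feq_trans; eauto using feq_sym, feq_npair_check.
Qed.

Lemma absolute_pair_in a b f : absolute (pair_in a b f).
Proof. apply absolute_ex_in, absolute_is_pair. Qed.

Lemma absolute_is_omega w : absolute (is_omega w).
Proof. intros q z. now rewrite forces_is_omega, sat_is_omega, feq_check. Qed.

Lemma absolute_is_nat a : absolute (is_nat a).
Proof. apply absolute_ex, absolute_and; auto using absolute_is_omega, absolute_mem. Qed.

(** Elements of a ground set are ground, and both components are reached from the pair by descending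
    twice through membership. *)
Lemma npair_grounded a b p x :
  feq (npair a b) (check p) x ->
  exists u v, p = gpair u v /\ feq a (check u) x /\ feq b (check v) x.
Proof.
  intros H.
  assert (K : forall s c, fmem s c x -> grounded c x -> grounded s x).
  { intros s c F [d E]. apply (fmem_congr _ _ _ _ E) in F.
    apply fmem_check in F as (w & _ & F). now exists w. }
  assert (G : grounded (npair a b) x) by (now exists p).
  assert (L : grounded (nupair a b) x).
  { apply (K _ (npair a b)); [apply fmem_nupair; right; apply feq_refl | exact G]. }
  destruct (K a (nupair a b)) as [u Hu]; [apply fmem_nupair; left; apply feq_refl | exact L |].
  destruct (K b (nupair a b)) as [v Hv]; [apply fmem_nupair; right; apply feq_refl | exact L |].
  exists u, v. repeat split; auto. apply (feq_check _ _ x).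
  eapply feq_trans; [apply feq_sym, H |]. eapply feq_trans; [apply feq_npair; eauto |].
  apply feq_npair_check.
Qed.

Lemma npair_in_check a b f x :
  fmem (npair a b) (check f) x <->
  exists u v, mem (gpair u v) f /\ feq a (check u) x /\ feq b (check v) x.
Proof.
  rewrite fmem_check. split.
  - intros (p & Hp & H). apply npair_grounded in H as (u & v & -> & Ha & Hb). eauto.
  - intros (u & v & H & Ha & Hb). exists (gpair u v). split; [exact H |].
    eapply feq_trans; [apply feq_npair; eassumption | apply feq_npair_check].
Qed.

(** * Functions, forced and in the ground model *)

Lemma boxed_is_function f : boxed (is_function f) (fun e y =>
  (forall s, fmem s (e f) y -> exists a b, feq s (npair a b) y) /\
  (forall a b c, fmem (npair a b) (e f) y -> fmem (npair a c) (e f) y -> feq b c y)).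
Proof.
  apply boxed_and.
  - eapply boxed_iff; [| apply boxed_all_imp]. intros e y.
    split; intros H s Hs; destruct (H s Hs) as (a & b & K); exists a, b;
      [rewrite forces_is_pair in K | apply forces_is_pair]; exact K.
  - eapply boxed_iff; [| apply boxed_all, boxed_all, boxed_all, boxed_imp, boxed_imp, boxed_forces].
    intros e y. split.
    + intros H a b c. specialize (H a b c). cbv beta in H. rewrite !forces_pair_in in H. exact H.
    + intros H a b c. rewrite !forces_pair_in. exact (H a b c).
Qed.

Lemma boxed_has_domain f d : boxed (has_domain f d) (fun e y =>
  forall a, fmem a (e d) y <-> exists b, fmem (npair a b) (e f) y).
Proof.
  eapply boxed_iff; [| apply boxed_all_iff]. intros e y.
  assert (K : forall a, forces (Ex (pair_in 1 0 (2 + f))) (a .: e) y <->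
                        exists b, fmem (npair a b) (e f) y).
  { intros a. split; intros [b H]; exists b; [rewrite forces_pair_in in H | apply forces_pair_in]; exact H. }
  split; intros H a; specialize (H a); rewrite K in *; exact H.
Qed.

Lemma boxed_range_in f r : boxed (range_in f r) (fun e y =>
  forall a b, fmem (npair a b) (e f) y -> fmem b (e r) y).
Proof.
  eapply boxed_iff; [| apply boxed_all, boxed_all, boxed_imp, boxed_forces]. intros e y.
  split; intros H a b; specialize (H a b); cbv beta in *; rewrite forces_pair_in in *; exact H.
Qed.

Lemma sat_is_function e f : sat mem e (is_function f) <->
  (forall p, mem p (e f) -> exists u v, p = gpair u v) /\
  (forall u v w, mem (gpair u v) (e f) -> mem (gpair u w) (e f) -> v = w).
Proof.
  unfold is_function, AllIn. cbn [sat]. split; intros [H K]; split.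
  - intros p Hp. destruct (H p Hp) as (u & v & E). exists u, v. rewrite sat_is_pair in E. exact E.
  - intros u v w. specialize (K u v w). rewrite !sat_pair_in in K. exact K.
  - intros p Hp. destruct (H p Hp) as (u & v & E). exists u, v. rewrite sat_is_pair. exact E.
  - intros u v w. rewrite !sat_pair_in. exact (K u v w).
Qed.

Lemma sat_has_domain e f d : sat mem e (has_domain f d) <->
  forall u, mem u (e d) <-> exists v, mem (gpair u v) (e f).
Proof.
  assert (K : forall u, sat mem (u .: e) (Ex (pair_in 1 0 (2 + f))) <->
                        exists v, mem (gpair u v) (e f)).
  { intros u. split; intros [v H]; exists v; [rewrite sat_pair_in in H | apply sat_pair_in]; exact H. }
  split; intros H u; specialize (H u).
  - rewrite <- K. exact H.
  - rewrite <- K in H. exact H.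
Qed.

Lemma sat_range_in e f r : sat mem e (range_in f r) <->
  forall u v, mem (gpair u v) (e f) -> mem v (e r).
Proof.
  split; intros H u v; specialize (H u v); cbn [sat] in *; rewrite sat_pair_in in *; exact H.
Qed.

(** The univalence clause quantifies over three names that become ground only through two nested
    premises, a shape that [absolute_all_imp] does not cover; hence the computation with
    [npair_in_check]. *)
Lemma absolute_is_function f : absolute (is_function f).
Proof.
  intros q x. rewrite (boxed_is_function f _ x), box_check, sat_is_function. split.
  - intros H. destruct (H x) as [H1 H2]. split.
    + intros p Hp. destruct (H1 (check p)) as (a & b & E); [now apply fmem_check2 |].
      apply feq_sym, npair_grounded in E as (u & v & -> & _). eauto.
    + intros u v w Hv Hw. apply (feq_check _ _ x), (H2 (check u)); apply npair_in_check;
        [exists u, v | exists u, w]; auto using feq_refl.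
  - intros [H1 H2] z. split.
    + intros s Hs. apply fmem_check in Hs as (p & Hp & E). destruct (H1 p Hp) as (u & v & ->).
      exists (check u), (check v). eapply feq_trans; [exact E | apply feq_sym, feq_npair_check].
    + intros a b c Hb Hc. apply npair_in_check in Hb as (u & v & Hv & Ea & Eb).
      apply npair_in_check in Hc as (u' & w & Hw & Ea' & Ec).
      assert (u = u') as <-. { apply (feq_check _ _ z). eauto using feq_sym, feq_trans. }
      rewrite (H2 _ _ _ Hv Hw) in Eb. eauto using feq_sym, feq_trans.
Qed.

Lemma absolute_has_domain f d : absolute (has_domain f d).
Proof.
  apply absolute_all_iff.
  - apply absolute_mem.
  - apply absolute_ex, absolute_pair_in.
  - apply guard_mem.
  - intros q s z [b H]. rewrite forces_pair_in in H.
    apply npair_in_check in H as (u & _ & _ & E & _). now exists u.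
Qed.

Lemma absolute_range_in f r : absolute (range_in f r).
Proof.
  intros q x. rewrite (boxed_range_in f r _ x), box_check, sat_range_in. split.
  - intros H u v K. apply (fmem_check2 _ _ x), (H x (check u)), npair_in_check.
    do 2 eexists. split; [exact K | split; apply feq_refl].
  - intros H z a b K. apply npair_in_check in K as (u & v & K & _ & E).
    apply fmem_check. eauto.
Qed.

(** * The axioms *)

Lemma valid_extensionality : valid ax_extensionality.
Proof.
  apply valid_all, valid_all, valid_imp. intros e x H.
  exact (forces_extensionality 1 0 e x H).
Qed.

Lemma valid_pairing : valid ax_pairing.
Proof.
  apply valid_all, valid_all. intros e x. exists (nupair (e 1) (e 0)).
  apply forces_is_upair, feq_refl.
Qed.

Definition dom (s : name) : Type := match s with Nm A _ _ _ => A end.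

Definition sub (s : name) : dom s -> name := match s with Nm _ f _ _ => f end.

Definition opn (s : name) : dom s -> R -> Prop := match s with Nm _ _ U _ => U end.

Lemma fmem_sub s t x : fmem s t x <-> exists i, near (opn t i) x /\ feq s (sub t i) x.
Proof. now destruct t. Qed.

Lemma sub_fmem t i x : near (opn t i) x -> fmem (sub t i) t x.
Proof. intros H. apply fmem_sub. exists i. split; [exact H | apply feq_refl]. Qed.

Lemma mem_ev_sub t i x : near (opn t i) x -> mem (ev (sub t i) x) (ev t x).
Proof. intros H. now apply fmem_ev, sub_fmem. Qed.

Lemma near_and_iff P Q x : near (fun y => P y /\ Q y) x <-> near P x /\ near Q x.
Proof.
  split; [| intros []; now apply near_and].
  intros H. split; revert H; apply near_mono; tauto.
Qed.

Lemma near_forces φ e x : near (forces φ e) x <-> forces φ e x.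
Proof. split; [apply near_self | apply forces_near]. Qed.

(** The settled part repeats the whole union of the settled value of [a], because elements of
    [ev a r] that stem from [h] have no subname whose elements could be collected. *)
Definition nunion (a : name) : name :=
  Nm {i : dom a & dom (sub a i)} (fun p => sub (sub a (projT1 p)) (projT2 p))
    (fun p y => opn a (projT1 p) y /\ opn (sub a (projT1 p)) (projT2 p) y)
    (fun r => gunion (ev a r)).

Lemma fmem_nunion s a x : fmem s (nunion a) x <-> exists t, fmem t a x /\ fmem s t x.
Proof.
  simpl. split.
  - intros ([i j] & H & E). apply near_and_iff in H as [H K].
    exists (sub a i). split; [now apply sub_fmem |]. apply fmem_sub. now exists j.
  - intros (t & Ht & Hs). apply fmem_sub in Ht as (i & Hi & E).
    apply (fmem_congr _ _ _ _ E), fmem_sub in Hs as (j & Hj & K).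
    exists (existT _ i j). split; [now apply near_and | exact K].
Qed.

Lemma ev_nunion a y : ev (nunion a) y = gunion (ev a y).
Proof.
  apply gset_ext. intros u. unfold nunion. rewrite mem_ev. split; [| now right].
  intros [([i j] & H & ->) | H]; [| exact H]. apply near_and_iff in H as [H K].
  apply mem_gunion. exists (ev (sub a i) y). split; now apply mem_ev_sub.
Qed.

Lemma valid_union : valid ax_union.
Proof.
  apply valid_all. intros e x. exists (nunion (e 0)).
  apply (forces_comprehension (ExIn 2 (1 ∈ 0)) 0 (nunion (e 0))); [| apply feq_refl].
  apply near_all. intros y. split.
  - intros s. rewrite fmem_nunion. reflexivity.
  - intros z s. rewrite ev_nunion, fmem_check. split.
    + intros (t & Ht & Hs). apply fmem_check in Ht as (v & Hv & E).
      apply (fmem_congr _ _ _ _ E), fmem_check in Hs as (u & Hu & K).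
      exists u. split; [apply mem_gunion; eauto | exact K].
    + intros (u & Hu & E). apply mem_gunion in Hu as (v & Hv & Hu).
      exists (check v). split; [now apply fmem_check2 | apply fmem_check; eauto].
Qed.

Lemma valid_infinity : valid ax_infinity.
Proof. intros e x. exists (check gomega). apply forces_is_omega, feq_refl. Qed.

(** Two inductions are needed. The premise about the elements of a name is boxed, so establishing it
    also requires the conclusion at the settled stage, where the elements are ground. *)
Lemma valid_set_induction φ : valid (ax_set_induction φ).
Proof.
  set (ψ := AllIn 0 (ren (0 .: (fun n => 2 + n)) φ)).
  assert (Hψ : boxed ψ (fun e y => forall t, fmem t (e 0) y -> forces φ (t .: (fun n => e (S n))) y)).
  { eapply boxed_iff; [| apply boxed_all_imp]. intros e y.
    assert (K : forall t, forces (ren (0 .: (fun n => 2 + n)) φ) (t .: e) y <->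
                          forces φ (t .: (fun n => e (S n))) y).
    { intros t. rewrite forces_ren.
      replace (fun n => (t .: e) ((0 .: (fun n => 2 + n)) n)) with (t .: (fun n => e (S n))); [reflexivity |].
      extensionality n. now destruct n. }
    split; intros H t; specialize (H t); rewrite K in *; exact H. }
  set (step := fun e y => forall s, forces ψ (s .: e) y -> forces φ (s .: e) y).
  (* Over a settled assignment the elements of [check u] are ground up to forced equality, so
     induction along [mem] suffices. *)
  assert (ground : forall e y, (forall z, step (settle e y) z) ->
                   forall u z, forces φ (check u .: settle e y) z).
  { intros e y H u. induction (mem_wf u) as [u _ IH]. intros z. apply H, Hψ.
    apply near_all. intros w.
    assert (K : forall v t, fmem t (check u) v -> forces φ (t .: settle e y) v).
    { intros v t Ht. apply fmem_check in Ht as (u' & Hu & E).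
      apply (forces_cong0 _ _ _ _ _ (feq_sym _ _ _ E)). now apply IH. }
    split; [apply K |]. intros v. rewrite settle_scons, settle_settle, ev_check. apply K. }
  (* Structural induction on the name handles the unsettled half; [ground] handles the settled
     one. *)
  assert (main : forall s e y, box step e y -> forces φ (s .: e) y).
  { induction s as [A f IH U h]. intros e y H. apply (box_self _ _ _ H), Hψ.
    generalize (box_box _ _ _ H). apply near_mono. intros w [K _]. split.
    - intros t (a & _ & E). apply (forces_cong0 _ _ _ _ _ (feq_sym _ _ _ E)). now apply IH.
    - intros v t Ht. rewrite settle_scons in *. apply fmem_check in Ht as (u & _ & E).
      apply (forces_cong0 _ _ _ _ _ (feq_sym _ _ _ E)). apply ground, box_settled, K. }
  apply valid_imp. intros e x H. apply (boxed_all_imp ψ φ) in H.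
  apply (box_intro (box step)); [apply box_box | exact H |].
  intros e' y K s. now apply main.
Qed.

(** The settled value separates by truth in the ground model. This agrees with forcing for settled
    parameters when [φ] is absolute, which is where boundedness enters. *)
Definition nsep (φ : form) (a : name) (e : nat -> name) : name :=
  Nm (dom a) (sub a) (fun i y => opn a i y /\ forces φ (sub a i .: e) y)
    (fun r => gsep (ev a r) (fun u => sat mem (u .: (fun n => ev (e n) r)) φ)).

Lemma valid_separation φ : bounded φ -> valid (ax_separation φ).
Proof.
  intros Hb. pose proof (absolute_bounded _ Hb) as Habs.
  apply valid_all. intros e x. set (N := nsep φ (e 0) e). exists N.
  apply (forces_comprehension (0 ∈ 2 ⊓ ren (0 .: (fun n => 2 + n)) φ) 0 N); [| apply feq_refl].
  assert (Eren : forall s (t : name) (e : nat -> name) y, forces (ren (0 .: (fun n => 2 + n)) φ) (s .: t .: e) y <->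
                 forces φ (s .: e) y).
  { intros s t e' y. rewrite forces_ren.
    replace (fun n => (s .: t .: e') ((0 .: (fun n => 2 + n)) n)) with (s .: e'); [reflexivity |].
    extensionality n. now destruct n. }
  apply near_all. intros y.
  (* The elements present near [y] add nothing to the settled part: [φ], forced of them, persists to
     their settled values, where it becomes truth by absoluteness. *)
  assert (Eev : ev N y = gsep (ev (e 0) y) (fun u => sat mem (u .: (fun n => ev (e n) y)) φ)).
  { apply gset_ext. intros u. unfold N, nsep. rewrite mem_ev. split; [| now right].
    intros [(i & H & ->) | H]; [| exact H]. apply near_and_iff in H as [H K].
    apply near_forces in K. apply mem_gsep. split; [now apply mem_ev_sub |].
    apply (forces_settled _ _ _ y) in K. rewrite settle_scons in K.
    now apply (absolute_cons _ _ _ y Habs) in K. }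
  split.
  - intros s. cbn [forces]. rewrite Eren. unfold N, nsep. simpl. split.
    + intros [Hs F]. apply fmem_sub in Hs as (i & Hi & E). exists i. split; [| exact E].
      apply near_and_iff. split; [exact Hi |]. apply near_forces. exact (forces_cong0 _ _ _ _ _ E F).
    + intros (i & H & E). apply near_and_iff in H as [H K]. apply near_forces in K. split.
      * apply fmem_sub. eauto.
      * exact (forces_cong0 _ _ _ _ _ (feq_sym _ _ _ E) K).
  - intros z s. rewrite settle_scons. cbn [forces]. rewrite Eren, Eev.
    change (fmem s (check (ev (e 0) y)) z /\ forces φ (s .: settle e y) z <->
            fmem s (check (gsep (ev (e 0) y) (fun u => sat mem (u .: (fun n => ev (e n) y)) φ))) z).
    rewrite !fmem_check. split.
    + intros [(u & Hu & E) F]. exists u. split; [| exact E]. apply mem_gsep. split; [exact Hu |].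
      apply (forces_cong0 _ _ _ _ _ E) in F. now apply (absolute_cons _ _ _ z Habs) in F.
    + intros (u & Hu & E). apply mem_gsep in Hu as [Hu S]. split; [now exists u |].
      apply (forces_cong0 _ _ _ _ _ (feq_sym _ _ _ E)). now apply (absolute_cons _ _ _ z Habs).
Qed.

Lemma forces_cong1 φ t s s' e x : feq s s' x -> forces φ (t .: s .: e) x -> forces φ (t .: s' .: e) x.
Proof.
  intros E. apply forces_cong. generalize (feq_near _ _ _ E). apply near_mono.
  intros y H [|[|n]]; [apply feq_refl | exact H | apply feq_refl].
Qed.

(** At the settled stage a witness may be taken ground, by settling it. *)
Definition ncollect (φ : form) (e : nat -> name) (a : name) : name :=
  let w := fun i y => epsilon (inhabits a) (fun t => forces φ (t .: sub a i .: e) y) in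
  let g := fun r u => epsilon (inhabits gempty)
             (fun v => forall z, forces φ (check v .: check u .: settle e r) z) in
  Nm (dom a * R) (fun p => w (fst p) (snd p))
    (fun p y => opn a (fst p) y /\ forces φ (w (fst p) (snd p) .: sub a (fst p) .: e) y)
    (fun r => gsep (gimage (ev a r) (g r)) (fun v => exists u, mem u (ev a r) /\
                forall z, forces φ (check v .: check u .: settle e r) z)).

(** A witness that works at one real may fail at another. The index therefore pairs an element of
    [a] with a real, one witness being chosen for each pair; at [x] the pair [(i, x)] does the
    job. *)
Lemma ncollect_total φ e a s x :
  (forall s, fmem s a x -> exists t, forces φ (t .: s .: e) x) ->
  fmem s a x -> exists t, fmem t (ncollect φ e a) x /\ forces φ (t .: s .: e) x.
Proof.
  intros H Hs. apply fmem_sub in Hs as (i & Hi & E).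
  destruct (H (sub a i)) as [t Ht]; [now apply sub_fmem |].
  set (w := epsilon (inhabits a) (fun t => forces φ (t .: sub a i .: e) x)).
  assert (Hw : forces φ (w .: sub a i .: e) x).
  { unfold w. apply epsilon_spec. now exists t. }
  exists w. split; [| exact (forces_cong1 _ _ _ _ _ _ (feq_sym _ _ _ E) Hw)].
  exists (i, x). split; [| apply feq_refl]. apply near_and_iff. split; [exact Hi |].
  now apply near_forces.
Qed.

Lemma ncollect_sound φ e a t x :
  fmem t (ncollect φ e a) x -> exists s, fmem s a x /\ forces φ (t .: s .: e) x.
Proof.
  intros ([i y] & H & E). apply near_and_iff in H as [H K]. apply near_forces in K.
  exists (sub a i). split; [now apply sub_fmem |].
  exact (forces_cong0 _ _ _ _ _ (feq_sym _ _ _ E) K).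
Qed.

Lemma mem_ev_ncollect φ e a v x :
  mem v (ev (ncollect φ e a) x) ->
  exists u, mem u (ev a x) /\ forall z, forces φ (check v .: check u .: settle e x) z.
Proof.
  unfold ncollect. intros H. apply mem_ev in H as [([i y] & H & ->) | H].
  - apply near_and_iff in H as [H K]. apply near_forces in K.
    exists (ev (sub a i) x). split; [now apply mem_ev_sub |]. intros z.
    apply (forces_settled _ _ _ z) in K. now rewrite !settle_scons in K.
  - apply mem_gsep in H. apply H.
Qed.

Lemma ev_ncollect_total φ e a u x :
  mem u (ev a x) -> (exists z t, forces φ (t .: check u .: settle e x) z) ->
  exists v, mem v (ev (ncollect φ e a) x) /\ forall z, forces φ (check v .: check u .: settle e x) z.
Proof.
  intros Hu (z & t & H).
  set (v := epsilon (inhabits gempty) (fun v => forall z, forces φ (check v .: check u .: settle e x) z)).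
  (* The parameters are settled already, so settling at [z] only grounds the witness [t], and what
     results is forced at every real. *)
  assert (Hv : forall z, forces φ (check v .: check u .: settle e x) z).
  { unfold v. apply epsilon_spec. exists (ev t z). intros w.
    apply (forces_settled _ _ _ w) in H. now rewrite !settle_scons, settle_settle, ev_check in H. }
  exists v. split; [| exact Hv]. unfold ncollect. apply mem_ev. right. apply mem_gsep. split.
  - apply mem_gimage. now exists u.
  - now exists u.
Qed.

Lemma valid_strong_collection φ : valid (ax_strong_collection φ).
Proof.
  apply valid_all, valid_imp. intros e x H. apply boxed_all_imp in H.
  set (b := ncollect φ e (e 0)). exists b.
  assert (E1 : forall (u v w : name) (e : nat -> name) y,
    forces (ren (0 .: 1 .: (fun n => 3 + n)) φ) (v .: u .: w .: e) y <-> forces φ (v .: u .: e) y).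
  { intros. rewrite forces_ren. match goal with |- forces _ ?f _ <-> _ => replace f with (v .: u .: e0) end;
      [reflexivity |]. extensionality n. now destruct n as [|[|n]]. }
  assert (E2 : forall (u v w : name) (e : nat -> name) y,
    forces (ren (1 .: 0 .: (fun n => 3 + n)) φ) (u .: v .: w .: e) y <-> forces φ (v .: u .: e) y).
  { intros. rewrite forces_ren. match goal with |- forces _ ?f _ <-> _ => replace f with (v .: u .: e0) end;
      [reflexivity |]. extensionality n. now destruct n as [|[|n]]. }
  split; apply boxed_all_imp; revert H; apply near_mono; intros y [H1 H2].
  - split.
    + intros s Hs. destruct (ncollect_total φ e (e 0) s y H1 Hs) as (t & Ht & F).
      exists t. split; [exact Ht | now apply E1].
    + intros z s Hs. rewrite settle_scons. simpl in Hs.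
      destruct (H2 z s Hs) as [t Ht]. unfold settle in Hs. apply fmem_check in Hs as (u & Hu & E).
      apply (forces_cong1 _ _ _ _ _ _ E) in Ht.
      destruct (ev_ncollect_total φ e (e 0) u y Hu) as (v & Hv & F); [now exists z, t |].
      exists (check v). split; [now apply fmem_check2 |]. apply E1.
      exact (forces_cong1 _ _ _ _ _ _ (feq_sym _ _ _ E) (F z)).
  - split.
    + intros t Ht. destruct (ncollect_sound φ e (e 0) t y Ht) as (s & Hs & F).
      exists s. split; [exact Hs | now apply E2].
    + intros z t Ht. rewrite settle_scons. apply fmem_check in Ht as (v & Hv & E).
      destruct (mem_ev_ncollect φ e (e 0) v y Hv) as (u & Hu & F).
      exists (check u). split; [now apply fmem_check2 |]. apply E2.
      exact (forces_cong0 _ _ _ _ _ (feq_sym _ _ _ E) (F z)).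
Qed.

(** * Exponentiation *)

Open Scope R_scope.

(** A supremum argument on the segment from [z] to [y], parametrized by [f] on the unit interval. If
    [m] bounds the initial stretch on which [P] holds, openness of [Q] excludes [Q] at [m], and
    openness of [P] then carries [P] beyond [m] unless the end is reached. *)
Lemma interval_connected (P Q : R -> Prop) (z d : R) :
  (forall y, Rabs (y - z) < d -> P y -> near P y) ->
  (forall y, Rabs (y - z) < d -> Q y -> near Q y) ->
  (forall y, Rabs (y - z) < d -> P y \/ Q y) ->
  (forall y, Rabs (y - z) < d -> P y -> Q y -> False) ->
  P z -> forall y, Rabs (y - z) < d -> P y.
Proof.
  intros HP HQ Hor Hdis Hz y Hy.
  assert (Hd : 0 < d) by (pose proof (Rabs_pos (y - z)); lra).
  set (f := fun t => z + t * (y - z)).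
  assert (Hf : forall t, 0 <= t <= 1 -> Rabs (f t - z) < d).
  { intros t Ht. unfold f. replace (z + t * (y - z) - z) with (t * (y - z)) by ring.
    rewrite Rabs_mult, (Rabs_right t) by lra. pose proof (Rabs_pos (y - z)). nra. }
  assert (near_f : forall (S : R -> Prop) m, near S (f m) ->
            exists c, 0 < c /\ forall t, Rabs (t - m) < c -> S (f t)).
  { intros S m (c & Hc & H). exists (c / d). split; [now apply Rdiv_lt_0_compat |].
    intros t Ht. apply H. unfold f.
    replace (z + t * (y - z) - (z + m * (y - z))) with ((t - m) * (y - z)) by ring.
    rewrite Rabs_mult. apply Rle_lt_trans with (Rabs (t - m) * d).
    - apply Rmult_le_compat_l; [apply Rabs_pos | lra].
    - apply (Rmult_lt_compat_r d) in Ht; [| exact Hd].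
      replace (c / d * d) with c in Ht by (field; lra). exact Ht. }
  set (E := fun t => 0 <= t <= 1 /\ forall s, 0 <= s <= t -> P (f s)).
  assert (E0 : E 0).
  { split; [lra |]. intros s Hs. replace (f s) with z; [exact Hz |]. unfold f.
    replace s with 0 by lra. ring. }
  destruct (completeness E) as [m [Hub Hlub]].
  { exists 1. intros t [Ht _]. lra. }
  { now exists 0. }
  assert (Hm : 0 <= m <= 1).
  { split; [now apply Hub |]. apply Hlub. intros t [Ht _]. lra. }
  assert (approach : forall c, c < m -> exists t, c < t /\ E t).
  { intros c Hc. apply NNPP. intros N. assert (m <= c); [| lra]. apply Hlub. intros t Ht.
    destruct (Rle_dec t c); [assumption | exfalso; apply N; exists t; split; [lra | exact Ht]]. }
  assert (Hbelow : forall s, 0 <= s < m -> P (f s)).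
  { intros s [H0 Hs]. destruct (approach s Hs) as (t & Ht & [_ K]). apply K. lra. }
  assert (Pm : P (f m)).
  { destruct (Hor (f m) (Hf m Hm)) as [| Qm]; [assumption | exfalso].
    destruct (near_f Q m (HQ _ (Hf m Hm) Qm)) as (c & Hc & H).
    destruct (approach (m - c)) as (t & Ht & [Ht1 K]); [lra |].
    assert (t <= m) by (apply Hub; split; assumption).
    apply (Hdis (f t)); [now apply Hf | apply K; lra |].
    apply H. unfold Rabs. destruct (Rcase_abs _); lra. }
  destruct (near_f P m (HP _ (Hf m Hm) Pm)) as (c & Hc & H).
  (* Half of [c] keeps the point within the neighbourhood of [m]. Being in [E], the minimum is at
     most [m], so it cannot be [m + c / 2] and must be 1. *)
  assert (E1 : E (Rmin 1 (m + c / 2))).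
  { split.
    - split; [apply Rmin_glb; lra | apply Rmin_l].
    - intros s Hs. destruct (Rlt_dec s m) as [L | L]; [apply Hbelow; lra |].
      pose proof (Rmin_r 1 (m + c / 2)). apply H. unfold Rabs. destruct (Rcase_abs _); lra. }
  apply Hub in E1 as L.
  replace y with (f 1) by (unfold f; ring).
  apply E1. unfold Rmin in *. destruct (Rle_dec 1 (m + c / 2)); lra.
Qed.

Close Scope R_scope.

Definition func (f X Y : name) (y : R) : Prop :=
  ((forall s, fmem s f y -> exists a b, feq s (npair a b) y) /\
   (forall a b c, fmem (npair a b) f y -> fmem (npair a c) f y -> feq b c y)) /\
  (forall a, fmem a X y <-> exists b, fmem (npair a b) f y) /\
  (forall a b, fmem (npair a b) f y -> fmem b Y y).

Definition gfunc (f X Y : gset) : Prop :=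
  ((forall p, mem p f -> exists u v, p = gpair u v) /\
   (forall u v w, mem (gpair u v) f -> mem (gpair u w) f -> v = w)) /\
  (forall u, mem u X <-> exists v, mem (gpair u v) f) /\
  (forall u v, mem (gpair u v) f -> mem v Y).

Definition function_between (f x y : nat) : form :=
  is_function f ⊓ has_domain f x ⊓ range_in f y.

Lemma boxed_function_between f x y :
  boxed (function_between f x y) (fun e => func (e f) (e x) (e y)).
Proof.
  apply (boxed_and (is_function f)); [apply boxed_is_function |].
  apply boxed_and; [apply boxed_has_domain | apply boxed_range_in].
Qed.

Lemma sat_function_between f x y e :
  sat mem e (function_between f x y) <-> gfunc (e f) (e x) (e y).
Proof.
  unfold function_between. cbn [sat]. now rewrite sat_is_function, sat_has_domain, sat_range_in.
Qed.

Lemma absolute_function_between f x y : absolute (function_between f x y).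
Proof.
  apply absolute_and; [apply absolute_is_function |].
  apply absolute_and; [apply absolute_has_domain | apply absolute_range_in].
Qed.

Lemma func_check f X Y :
  (forall z, func (check f) (check X) (check Y) z) <-> gfunc f X Y.
Proof.
  set (q := f .: X .: Y .: (fun _ => f)).
  pose proof (absolute_function_between 0 1 2 q R0) as H.
  rewrite (boxed_function_between 0 1 2 _ R0), box_check, sat_function_between in H. exact H.
Qed.

(** The settled half of the [box] asks for [func] of canonical names at every real, which by
    absoluteness amounts to [gfunc] of the settled values. *)
Definition sfunc (f X Y : name) (x : R) : Prop :=
  near (fun y => func f X Y y /\ gfunc (ev f y) (ev X y) (ev Y y)) x.

Lemma forces_function_between f x y e r :
  forces (function_between f x y) e r <-> sfunc (e f) (e x) (e y) r.
Proof.
  rewrite (boxed_function_between f x y e r). split; apply near_mono; intros w [H K];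
    (split; [exact H |]); now apply func_check.
Qed.

Lemma sfunc_cong f g X Y x : feq f g x -> sfunc f X Y x -> sfunc g X Y x.
Proof.
  intros E H. apply (forces_function_between 0 1 2 (g .: X .: Y .: (fun _ => f))).
  apply (forces_cong0 _ _ _ _ _ E). now apply forces_function_between.
Qed.

Lemma near_sfunc f X Y x : near (sfunc f X Y) x <-> sfunc f X Y x.
Proof. split; [apply near_self | apply near_near]. Qed.

Lemma sfunc_check f X Y x : sfunc (check f) (check X) (check Y) x <-> gfunc f X Y.
Proof.
  split; intros H.
  - apply near_self in H. rewrite !ev_check in H. apply H.
  - apply near_all. intros y. rewrite !ev_check. split; [now apply func_check | exact H].
Qed.

Definition gexp (X Y : gset) : gset := gsep (gpow (gprod X Y)) (fun f => gfunc f X Y).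

Lemma gfunc_prod f X Y p : gfunc f X Y -> mem p f -> mem p (gprod X Y).
Proof.
  intros ((H1 & _) & H2 & H3) Hp. destruct (H1 p Hp) as (u & v & ->).
  apply mem_gprod. exists u, v. repeat split; [apply H2 | eapply H3]; eauto.
Qed.

Lemma mem_gexp f X Y : mem f (gexp X Y) <-> gfunc f X Y.
Proof.
  unfold gexp. rewrite mem_gsep, mem_gpow. split; [tauto |].
  intros H. split; [| exact H]. intros p. now apply gfunc_prod.
Qed.

(** [subrel] ranges over all subsets of [X × Y] up to forced equality; its index
    type is small because the settled part is given by a predicate. *)
Definition subrel_index (X Y : name) : Type :=
  ((dom X * dom Y -> R -> Prop) *
   (forall r, idx (gprod (ev X r) (ev Y r)) -> Prop))%type.

Definition subrel (X Y : name) (k : subrel_index X Y) : name :=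
  Nm (dom X * dom Y) (fun p => npair (sub X (fst p)) (sub Y (snd p)))
    (fun p y => opn X (fst p) y /\ opn Y (snd p) y /\ fst k p y)
    (fun r => sup (fun i : {i | snd k r i} => el _ (proj1_sig i))).

(** The presence of a pair of subnames is defined as its forced membership in [f], and the settled
    part is cut down to the elements of [ev f r]. Names are too many to index [nexp], so each
    function is replaced by such a copy. *)
Lemma sfunc_subrel f X Y x : sfunc f X Y x -> exists k, feq f (subrel X Y k) x.
Proof.
  intros H.
  exists (fun p y => fmem (npair (sub X (fst p)) (sub Y (snd p))) f y,
          fun r i => mem (el _ i) (ev f r)).
  apply feq_ext. revert H. apply near_mono. intros y [((H1 & _) & H2 & H3) G]. split.
  - intros s. split.
    + intros Hs. destruct (H1 s Hs) as (a & b & E).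
      pose proof (fmem_congl _ _ _ _ E Hs) as Hp.
      assert (Ha : fmem a X y) by (apply H2; now exists b).
      pose proof (H3 a b Hp) as Hb.
      apply fmem_sub in Ha as (i & Hi & Ei). apply fmem_sub in Hb as (j & Hj & Ej).
      exists (i, j). split.
      * apply near_and3; [exact Hi | exact Hj |]. apply fmem_near.
        apply (fmem_congl (npair a b)); [now apply feq_npair | exact Hp].
      * eapply feq_trans; [exact E | now apply feq_npair].
    + intros ([i j] & K & E). rewrite !near_and_iff in K. destruct K as (_ & _ & K).
      apply near_self in K. exact (fmem_congl _ _ _ _ (feq_sym _ _ _ E) K).
  - apply gset_ext. intros u. unfold subrel. rewrite mem_ev, mem_sup. split.
    + intros Hu. right. destruct (gfunc_prod _ _ _ _ G Hu) as [i Hi].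
      rewrite <- Hi in Hu. exists (exist _ i Hu). now symmetry.
    + intros [([i j] & K & ->) | [[i Hi] ->]]; [| exact Hi].
      rewrite !near_and_iff in K. destruct K as (_ & _ & K). apply near_self in K.
      now apply fmem_ev.
Qed.

(** Every ground function between the settled values is put into the settled part, since after
    settling the name has to act as the full ground exponential. *)
Definition nexp (X Y : name) : name :=
  Nm (subrel_index X Y) (subrel X Y) (fun k => sfunc (subrel X Y k) X Y)
    (fun r => gexp (ev X r) (ev Y r)).

Lemma fmem_nexp f X Y x : fmem f (nexp X Y) x <-> sfunc f X Y x.
Proof.
  simpl. split.
  - intros (k & H & E). apply near_sfunc in H. exact (sfunc_cong _ _ _ _ _ (feq_sym _ _ _ E) H).
  - intros H. destruct (sfunc_subrel _ _ _ _ H) as [k E]. exists k. split; [| exact E].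
    apply near_sfunc. exact (sfunc_cong _ _ _ _ _ E H).
Qed.

Lemma ev_nexp X Y y : ev (nexp X Y) y = gexp (ev X y) (ev Y y).
Proof.
  apply gset_ext. intros u. unfold nexp. rewrite mem_ev. split; [| now right].
  intros [(k & H & ->) | H]; [| exact H]. apply near_self, near_self in H. apply mem_gexp, H.
Qed.

(** A function between ground sets is locally constant, hence constant on an
    interval, hence ground. *)
Lemma sfunc_ground f X Y x : sfunc f (check X) (check Y) x -> exists g, gfunc g X Y /\ feq f (check g) x.
Proof.
  intros (d & Hd & H).
  assert (HG : forall y, (Rabs (y - x) < d)%R -> gfunc (ev f y) X Y).
  { intros y Hy. destruct (H y Hy) as [_ K]. now rewrite !ev_check in K. }
  assert (Hx : (Rabs (x - x) < d)%R) by (rewrite Rminus_diag, Rabs_R0; exact Hd).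
  set (g := ev f x).
  assert (const : forall u v, mem (gpair u v) g -> forall y, (Rabs (y - x) < d)%R ->
                  fmem (npair (check u) (check v)) f y).
  { intros u v Huv.
    (* The competing open condition is that [u] has a ground value other than [v]. Values lie in the
       ground set [Y], so each is ground, and univalence makes the two conditions disjoint. *)
    apply (interval_connected _ (fun y => exists w, w <> v /\ fmem (npair (check u) (check w)) f y)).
    - intros y _. apply fmem_near.
    - intros y _ (w & Hw & K). apply fmem_near in K. revert K. apply near_mono. eauto.
    - intros y Hy. destruct (H y Hy) as [(_ & H2 & H3) _].
      destruct (proj1 (H2 (check u))) as [b Hb].
      + apply fmem_check2. apply (HG x Hx). now exists v.
      + pose proof (H3 _ _ Hb) as K. apply fmem_check in K as (w & _ & E).
        apply (fmem_congl _ (npair (check u) (check w))) in Hb;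
          [| now apply feq_npair; [apply feq_refl |]].
        destruct (classic (w = v)) as [-> |]; [now left | right; eauto].
    - intros y Hy Hv (w & Hw & K). destruct (H y Hy) as [((_ & H1) & _) _].
      apply Hw. apply (feq_check _ _ y). eauto.
    - destruct (H x Hx) as [(_ & H2 & H3) _].
      destruct (proj1 (H2 (check u))) as [b Hb].
      + apply fmem_check2. apply (HG x Hx). now exists v.
      + pose proof (H3 _ _ Hb) as K. apply fmem_check in K as (w & _ & E).
        apply (fmem_congl _ (npair (check u) (check w))) in Hb;
          [| now apply feq_npair; [apply feq_refl |]].
        replace v with w; [exact Hb |].
        apply fmem_ev in Hb. rewrite ev_npair, !ev_check in Hb.
        destruct (HG x Hx) as ((_ & F) & _). exact (F _ _ _ Hb Huv). }
  assert (Hev : forall y, (Rabs (y - x) < d)%R -> ev f y = g).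
  { intros y Hy.
    (* One inclusion is enough, because [g] and [ev f y] are functions with the same domain [X]. *)
    assert (sub : forall p, mem p g -> mem p (ev f y)).
    { intros p Hp. destruct (HG x Hx) as ((F & _) & _). destruct (F p Hp) as (u & v & ->).
      pose proof (fmem_ev _ _ _ (const u v Hp y Hy)) as K. now rewrite ev_npair, !ev_check in K. }
    apply gset_ext. intros p. split; [| apply sub]. intros Hp.
    destruct (HG y Hy) as ((F1 & F2) & F3 & _). destruct (F1 p Hp) as (u & v & ->).
    destruct (HG x Hx) as (_ & K & _). destruct (proj1 (K u)) as [w Hw].
    - apply F3. now exists v.
    - now rewrite (F2 _ _ _ Hp (sub _ Hw)). }
  exists g. split; [exact (HG x Hx) |]. apply feq_ext. exists d. split; [exact Hd |].
  intros y Hy. split; [| rewrite ev_check; now apply Hev].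
  intros s. rewrite fmem_check. split.
  - intros Hs. destruct (H y Hy) as [((H1 & _) & H2 & H3) _].
    destruct (H1 s Hs) as (a & b & E). pose proof (fmem_congl _ _ _ _ E Hs) as Hp.
    assert (Ha : fmem a (check X) y) by (apply H2; now exists b).
    pose proof (H3 a b Hp) as Hb.
    apply fmem_check in Ha as (u & _ & Eu). apply fmem_check in Hb as (v & _ & Ev).
    assert (E' : feq s (check (gpair u v)) y).
    { eapply feq_trans; [exact E |]. eapply feq_trans; [apply feq_npair; eassumption | apply feq_npair_check]. }
    exists (gpair u v). split; [| exact E'].
    pose proof (fmem_ev _ _ _ (fmem_congl _ _ _ _ E' Hs)) as K. now rewrite ev_check, Hev in K.
  - intros (p & Hp & E). destruct (HG x Hx) as ((F & _) & _).
    destruct (F p Hp) as (u & v & ->). apply (fmem_congl (npair (check u) (check v))).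
    + eapply feq_trans; [apply feq_npair_check | now apply feq_sym].
    + now apply const.
Qed.

(** The unsettled half holds by construction of [nexp]. The settled half needs [sfunc_ground]: names
    of functions between ground sets are ground, so the ground exponential misses none. *)
Lemma valid_exponentiation : valid ax_exponentiation.
Proof.
  apply valid_all, valid_all. intros e x. exists (nexp (e 1) (e 0)).
  apply (forces_comprehension (function_between 0 3 2) 0 (nexp (e 1) (e 0))); [| apply feq_refl].
  apply near_all. intros y. split.
  - intros f. rewrite forces_function_between, fmem_nexp. reflexivity.
  - intros z f. rewrite forces_function_between, ev_nexp, fmem_check.
    change (sfunc f (check (ev (e 1) y)) (check (ev (e 0) y)) z <->
            exists g, mem g (gexp (ev (e 1) y) (ev (e 0) y)) /\ feq f (check g) z).
    split.
    + intros H. destruct (sfunc_ground _ _ _ _ H) as (g & Hg & E). exists g.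
      now rewrite mem_gexp.
    + intros (g & Hg & E). apply mem_gexp in Hg. apply (sfunc_cong _ _ _ _ _ (feq_sym _ _ _ E)).
      now apply sfunc_check.
Qed.

Lemma valid_CZF_Exp φ : CZF_Exp φ -> valid φ.
Proof.
  destruct 1; auto using valid_extensionality, valid_pairing, valid_union, valid_infinity,
    valid_exponentiation, valid_universal_closure, valid_set_induction, valid_separation,
    valid_strong_collection.
Qed.

(** * Rational numbers *)

Lemma guard_pair_in i j : guard (pair_in (S i) 0 (S j)).
Proof.
  intros q s z H. rewrite forces_pair_in in H.
  apply npair_in_check in H as (_ & v & _ & _ & E). now exists v.
Qed.

Lemma absolute_iterate R p z n y :
  (forall i j k, absolute (R i j k)) -> absolute (iterate R p z n y).
Proof.
  intros HR. apply absolute_ex, absolute_ex.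
  apply absolute_and; [apply absolute_is_omega |].
  apply absolute_and; [apply absolute_is_function |].
  apply absolute_and; [apply absolute_has_domain |].
  apply absolute_and; [| apply absolute_and; [| apply absolute_pair_in]].
  - apply absolute_ex, absolute_and; auto using absolute_is_empty, absolute_pair_in.
  - apply absolute_all_in, absolute_all_imp; auto using absolute_pair_in, guard_pair_in.
    apply absolute_ex, absolute_ex. repeat apply absolute_and;
      auto using absolute_is_succ, absolute_pair_in.
Qed.

Lemma absolute_is_sum a b c : absolute (is_sum a b c).
Proof. apply absolute_iterate. intros. apply absolute_is_succ. Qed.

Lemma absolute_is_prod a b c : absolute (is_prod a b c).
Proof.
  apply absolute_ex, absolute_and; [apply absolute_is_empty |].
  apply absolute_iterate. intros. apply absolute_is_sum.
Qed.

Lemma absolute_is_sum_prod a b c d k : absolute (is_sum_prod a b c d k).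
Proof.
  apply absolute_ex, absolute_ex.
  apply absolute_and; [apply absolute_is_prod |].
  apply absolute_and; [apply absolute_is_prod | apply absolute_is_sum].
Qed.

Lemma absolute_is_fraction t a b c : absolute (is_fraction t a b c).
Proof.
  apply absolute_and; [apply absolute_is_nat |].
  apply absolute_and; [apply absolute_is_nat |].
  apply absolute_and; [apply absolute_is_nat |].
  apply absolute_and; [apply absolute_imp; [apply absolute_is_empty | apply absolute_bot] |].
  apply absolute_ex, absolute_and; apply absolute_is_pair.
Qed.

Lemma absolute_compare_fractions P t t' : absolute P -> absolute (compare_fractions P t t').
Proof.
  intros HP. unfold compare_fractions. do 6 apply absolute_ex.
  apply absolute_and; [apply absolute_is_fraction |].
  apply absolute_and; [apply absolute_is_fraction |].
  apply absolute_ex, absolute_ex.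
  apply absolute_and; [apply absolute_is_sum_prod |].
  apply absolute_and; [apply absolute_is_sum_prod | exact HP].
Qed.

Lemma absolute_rational_lt q r : absolute (rational_lt q r).
Proof. apply absolute_ex_in, absolute_ex_in, absolute_compare_fractions, absolute_mem. Qed.

(** The sequence of iterates is [num (g m)]. Any function that witnesses the formula agrees with it
    by induction along the step clause; conversely its graph is a witness. The hypothesis on [R]
    allows arbitrary assignments because [R] is evaluated under further binders. *)
Lemma sat_iterate (g : nat -> nat) R p z n y k (e : nat -> gset) :
  (forall e' i j l m, e' i = e p -> e' l = num (g m) ->
     sat mem e' (R i j l) <-> e' j = num (g (S m))) ->
  e z = num (g 0) -> e n = num k ->
  sat mem e (iterate R p z n y) <-> e y = num (g k).
Proof.
  intros HR Hz Hn. unfold iterate. split.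
  - intros (w & f & Hw & Hf & _ & (z0 & Hz0 & H0) & Hstep & Hy).
    rewrite sat_is_omega in Hw. rewrite sat_is_function in Hf. rewrite sat_is_empty in Hz0.
    rewrite sat_pair_in in H0, Hy. simpl in Hw, Hf, Hz0, H0, Hy. subst w z0.
    rewrite Hz in H0. rewrite Hn in Hy.
    assert (K : forall m, mem (gpair (num m) (num (g m))) f).
    { induction m as [|m IH]; [exact H0 |].
      destruct (Hstep (num m)) with (d := num (g m)) as (m' & v' & Hm & HRm & Hp).
      - apply mem_gomega. now exists m.
      - rewrite sat_pair_in. exact IH.
      - rewrite sat_is_succ in Hm. rewrite (HR _ _ _ _ m) in HRm by reflexivity.
        rewrite sat_pair_in in Hp. simpl in Hm, HRm, Hp. now subst m' v'. }
    destruct Hf as [_ Hf]. exact (Hf _ _ _ Hy (K k)).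
  - intros Hy. set (f := sup (fun m => gpair (num m) (num (g m)))).
    assert (Hf : forall u v, mem (gpair u v) f <-> exists m, u = num m /\ v = num (g m)).
    { intros u v. unfold f. rewrite mem_sup. split.
      - intros [m E]. apply gpair_inj in E. eauto.
      - intros (m & -> & ->). now exists m. }
    exists gomega, f. refine (conj _ (conj _ (conj _ (conj _ (conj _ _))))).
    + now apply sat_is_omega.
    + apply sat_is_function. simpl. split.
      * intros q Hq. apply mem_sup in Hq as [m ->]. eauto.
      * intros u v w Hv Hw. apply Hf in Hv as (m & -> & ->), Hw as (m' & E & ->).
        apply num_inj in E. now subst.
    + apply sat_has_domain. simpl. intros u. rewrite mem_gomega. split.
      * intros [m ->]. exists (num (g m)). apply Hf. eauto.
      * intros [v Hv]. apply Hf in Hv as (m & -> & _). eauto.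
    + exists (num 0). split; [now apply sat_is_empty |]. apply sat_pair_in. simpl.
      apply Hf. exists 0. auto.
    + intros u Hu v Hv. rewrite sat_pair_in in Hv. simpl in Hv.
      apply Hf in Hv as (m & -> & ->). exists (num (S m)), (num (g (S m))).
      refine (conj _ (conj _ _)).
      * now apply sat_is_succ.
      * now apply (HR _ _ _ _ m).
      * apply sat_pair_in, Hf. now exists (S m).
    + apply sat_pair_in. simpl. rewrite Hn, Hy. apply Hf. eauto.
Qed.

Lemma sat_is_sum e a b c m n :
  e a = num m -> e b = num n -> sat mem e (is_sum a b c) <-> e c = num (m + n).
Proof.
  (* Commuting lets [k + m] reduce on the iteration count [k], so that the initial value and the
     step hold by computation. *)
  intros Ha Hb. rewrite Nat.add_comm. apply (sat_iterate (fun k => k + m)); auto.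
  intros e' i j l k _ Hl. rewrite sat_is_succ, Hl. reflexivity.
Qed.

Lemma sat_is_prod e a b c m n :
  e a = num m -> e b = num n -> sat mem e (is_prod a b c) <-> e c = num (m * n).
Proof.
  intros Ha Hb. rewrite Nat.mul_comm.
  assert (K : forall o, o = gempty ->
    sat mem (o .: e) (iterate (fun p v' v => is_sum v p v') (1 + a) 0 (1 + b) (1 + c)) <->
    e c = num (n * m)).
  { intros o Ho.
    apply (sat_iterate (fun k => k * m) (fun p v' v => is_sum v p v') (1 + a) 0 (1 + b) (1 + c) n (o .: e)); auto.
    intros e' i j l k Hi Hl. simpl in Hi. rewrite (sat_is_sum _ _ _ _ (k * m) m) by congruence.
    replace (S k * m) with (k * m + m) by ring. reflexivity. }
  unfold is_prod. split.
  - intros (o & Ho & H). rewrite sat_is_empty in Ho. now apply (K o).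
  - intros H. exists gempty. split; [now apply sat_is_empty | now apply K].
Qed.

Lemma sat_is_sum_prod e a b c d k m n m' n' :
  e a = num m -> e b = num n -> e c = num m' -> e d = num n' ->
  sat mem e (is_sum_prod a b c d k) <-> e k = num (m * n + m' * n').
Proof.
  intros Ha Hb Hc Hd. unfold is_sum_prod. split.
  - intros (u & v & Hu & Hv & H). rewrite (sat_is_prod _ _ _ _ m n) in Hu by assumption.
    rewrite (sat_is_prod _ _ _ _ m' n') in Hv by assumption.
    rewrite (sat_is_sum _ _ _ _ (m * n) (m' * n')) in H by assumption. exact H.
  - intros H. exists (num (m * n)), (num (m' * n')). refine (conj _ (conj _ _)).
    + now apply (sat_is_prod _ _ _ _ m n).
    + now apply (sat_is_prod _ _ _ _ m' n').
    + now apply (sat_is_sum _ _ _ _ (m * n) (m' * n')).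
Qed.

(** The denominator is [S c], so that it is never zero. *)
Definition frac (a b c : nat) : gset := gpair (gpair (num a) (num b)) (num (S c)).

Definition val (a b c : nat) : R := ((INR a - INR b) / INR (S c))%R.

Lemma frac_inj a b c a' b' c' : frac a b c = frac a' b' c' -> a = a' /\ b = b' /\ c = c'.
Proof.
  intros H. apply gpair_inj in H as [H K]. apply gpair_inj in H as [H L].
  apply num_inj in H, K, L. repeat split; congruence.
Qed.

Lemma sat_is_fraction e t a b c : sat mem e (is_fraction t a b c) <->
  exists m n k, e a = num m /\ e b = num n /\ e c = num (S k) /\ e t = frac m n k.
Proof.
  unfold is_fraction. split.
  - intros (Ha & Hb & Hc & Hc0 & p & Hp & Ht).
    apply sat_is_nat in Ha as [m Ha]. apply sat_is_nat in Hb as [n Hb].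
    apply sat_is_nat in Hc as [[|k] Hc]; [now destruct Hc0; apply sat_is_empty |].
    rewrite sat_is_pair in Hp, Ht. simpl in Hp, Ht.
    exists m, n, k. unfold frac. repeat split; congruence.
  - intros (m & n & k & Ha & Hb & Hc & Ht). 
    refine (conj _ (conj _ (conj _ (conj _ _)))); try (apply sat_is_nat; eauto).
    + intros H. apply sat_is_empty in H. rewrite Hc in H. now apply (num_inj (S k) 0) in H.
    + exists (gpair (num m) (num n)). rewrite !sat_is_pair. simpl. now rewrite Ha, Hb, Hc.
Qed.

Lemma sat_compare_fractions e P t t' : sat mem e (compare_fractions P t t') <->
  exists a b c a' b' c', e t = frac a b c /\ e t' = frac a' b' c' /\
    sat mem (num (a' * S c + b * S c') .: num (a * S c' + b' * S c) .:
             num (S c') .: num b' .: num a' .: num (S c) .: num b .: num a .: e) P.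
Proof.
  unfold compare_fractions. split.
  - intros (u & v & w & u' & v' & w' & Ht & Ht' & k & l & Hk & Hl & H).
    apply sat_is_fraction in Ht as (a & b & c & Ha & Hb & Hc & Ht).
    apply sat_is_fraction in Ht' as (a' & b' & c' & Ha' & Hb' & Hc' & Ht').
    simpl in Ha, Hb, Hc, Ht, Ha', Hb', Hc', Ht'. subst u v w u' v' w'.
    rewrite (sat_is_sum_prod _ _ _ _ _ _ a (S c') b' (S c)) in Hk by reflexivity.
    rewrite (sat_is_sum_prod _ _ _ _ _ _ a' (S c) b (S c')) in Hl by reflexivity.
    simpl in Hk, Hl. exists a, b, c, a', b', c'. subst k l. auto.
  - intros (a & b & c & a' & b' & c' & Ht & Ht' & H).
    exists (num a), (num b), (num (S c)), (num a'), (num b'), (num (S c')).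
    split; [apply sat_is_fraction; exists a, b, c; auto |].
    split; [apply sat_is_fraction; exists a', b', c'; auto |].
    do 2 eexists. split; [| split; [| exact H]].
    + now apply (sat_is_sum_prod _ _ _ _ _ _ a (S c') b' (S c)).
    + now apply (sat_is_sum_prod _ _ _ _ _ _ a' (S c) b (S c')).
Qed.

Lemma val_cross a b c a' b' c' :
  (val a' b' c' - val a b c = (INR (a' * S c + b * S c') - INR (a * S c' + b' * S c)) /
                              (INR (S c) * INR (S c')))%R.
Proof.
  unfold val. rewrite !plus_INR, !mult_INR. field. split; apply not_0_INR; discriminate.
Qed.

Lemma val_lt a b c a' b' c' :
  (val a b c < val a' b' c')%R <-> a * S c' + b' * S c < a' * S c + b * S c'.
Proof.
  pose proof (val_cross a b c a' b' c') as E.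
  set (k := a * S c' + b' * S c) in *. set (l := a' * S c + b * S c') in *.
  assert (D : (0 < / (INR (S c) * INR (S c')))%R).
  { apply Rinv_0_lt_compat, Rmult_lt_0_compat; apply lt_0_INR; lia. }
  unfold Rdiv in E. split; intros H.
  - apply INR_lt. assert (0 < INR l - INR k)%R; [| lra].
    apply (Rmult_lt_reg_r _ _ _ D). lra.
  - apply lt_INR in H. assert (0 < (INR l - INR k) * / (INR (S c) * INR (S c')))%R; [| lra].
    apply Rmult_lt_0_compat; lra.
Qed.

Lemma val_eq a b c a' b' c' :
  val a b c = val a' b' c' <-> a * S c' + b' * S c = a' * S c + b * S c'.
Proof.
  pose proof (val_lt a b c a' b' c'). pose proof (val_lt a' b' c' a b c).
  split; intros E.
  - destruct (lt_eq_lt_dec (a * S c' + b' * S c) (a' * S c + b * S c')) as [[L | ] | L]; [| assumption |].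
    + apply H in L. lra.
    + assert (val a' b' c' < val a b c)%R; [apply H0; lia | lra].
  - destruct (Rtotal_order (val a b c) (val a' b' c')) as [L | [|L]]; [| assumption |].
    + apply H in L. lia.
    + apply H0 in L. lia.
Qed.

Lemma sat_fraction_eq e t t' : sat mem e (fraction_eq t t') <->
  exists a b c a' b' c', e t = frac a b c /\ e t' = frac a' b' c' /\ val a b c = val a' b' c'.
Proof.
  unfold fraction_eq. rewrite sat_compare_fractions.
  split; intros (a & b & c & a' & b' & c' & Ht & Ht' & H);
    exists a, b, c, a', b', c'; repeat split; auto.
  - apply val_eq. now apply num_inj in H.
  - apply val_eq in H. simpl sat. unfold scons. now rewrite H.
Qed.

Lemma sat_fraction_lt e t t' : sat mem e (fraction_lt t t') <->
  exists a b c a' b' c', e t = frac a b c /\ e t' = frac a' b' c' /\ (val a b c < val a' b' c')%R.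
Proof.
  unfold fraction_lt. rewrite sat_compare_fractions.
  split; intros (a & b & c & a' & b' & c' & Ht & Ht' & H);
    exists a, b, c, a', b', c'; repeat split; auto.
  - apply val_lt. apply mem_num in H as (m & Hm & E). apply num_inj in E. now subst m.
  - apply val_lt in H. apply mem_num. eauto.
Qed.

Definition rational_value (v : R) : Prop := exists a b c, v = val a b c.

Definition triple_val (p : nat * nat * nat) : R := val (fst (fst p)) (snd (fst p)) (snd p).

(** The equivalence class of all fractions of value [v]. It is empty when [v] is irrational, so
    injectivity asks for [rational_value]. *)
Definition rational (v : R) : gset :=
  sup (fun p : {p | triple_val p = v} =>
    frac (fst (fst (proj1_sig p))) (snd (fst (proj1_sig p))) (snd (proj1_sig p))).

Lemma mem_rational u v : mem u (rational v) <-> exists a b c, v = val a b c /\ u = frac a b c.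
Proof.
  unfold rational. rewrite mem_sup. split.
  - intros [[[[a b] c] <-] ->]. now exists a, b, c.
  - intros (a & b & c & -> & ->). now exists (exist (fun p => triple_val p = val a b c) (a, b, c) eq_refl).
Qed.

Lemma rational_inj v w : rational_value v -> rational v = rational w -> v = w.
Proof.
  intros (a & b & c & Hv) H.
  assert (K : mem (frac a b c) (rational w)) by (rewrite <- H; apply mem_rational; eauto).
  apply mem_rational in K as (a' & b' & c' & -> & E).
  apply frac_inj in E as (-> & -> & ->). exact Hv.
Qed.

Lemma sat_rational_lt e q r v w :
  e q = rational v -> e r = rational w -> rational_value v -> rational_value w ->
  sat mem e (rational_lt q r) <-> (v < w)%R.
Proof.
  intros Hq Hr Rv Rw. unfold rational_lt. split.
  - intros (t & Ht & t' & Ht' & H). change (mem t (e q)) in Ht. change (mem t' (e r)) in Ht'.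
    rewrite Hq in Ht. rewrite Hr in Ht'. apply sat_fraction_lt in H as (a & b & c & a' & b' & c' & E & E' & H).
    simpl in E, E'. subst t t'. apply mem_rational in Ht as (m & n & k & -> & E).
    apply mem_rational in Ht' as (m' & n' & k' & -> & E').
    apply frac_inj in E as (-> & -> & ->), E' as (-> & -> & ->). exact H.
  - intros H. destruct Rv as (a & b & c & Hv), Rw as (a' & b' & c' & Hw).
    exists (frac a b c). split; [change (mem (frac a b c) (e q)); rewrite Hq; apply mem_rational; eauto |].
    exists (frac a' b' c'). split; [change (mem (frac a' b' c') (e r)); rewrite Hr; apply mem_rational; eauto |].
    apply sat_fraction_lt. exists a, b, c, a', b', c'. subst. auto.
Qed.

Lemma rational_value_dense (x y : R) : (x < y)%R -> exists v, rational_value v /\ (x < v < y)%R.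
Proof.
  intros H. destruct (archimed_cor1 (y - x)) as (n & Hn & Hpos); [lra |].
  destruct n as [|c]; [lia |].
  assert (Hc : (0 < INR (S c))%R) by (apply lt_0_INR; lia).
  destruct (archimed (x * INR (S c))) as [H1 H2].
  (* The least integer above [x] times the denominator: dividing it by [S c] overshoots [x] by at
     most [1 / S c], which is less than [y - x]. *)
  set (k := Rdefinitions.up (x * INR (S c))) in *.
  (* [Z.to_nat] sends negative integers to 0, so these are the positive and negative parts of [k],
     as a fraction requires. *)
  assert (Ek : (IZR k = INR (Z.to_nat k) - INR (Z.to_nat (- k)))%R).
  { rewrite !INR_IZR_INZ, <- minus_IZR. f_equal. lia. }
  exists (val (Z.to_nat k) (Z.to_nat (- k)) c). split; [now repeat eexists |].
  unfold val. rewrite <- Ek. split.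
  - apply (Rmult_lt_reg_r (INR (S c))); [exact Hc |].
    replace (IZR k / INR (S c) * INR (S c))%R with (IZR k) by (field; lra). lra.
  - apply (Rmult_lt_reg_r (INR (S c))); [exact Hc |].
    replace (IZR k / INR (S c) * INR (S c))%R with (IZR k) by (field; lra).
    apply (Rmult_lt_compat_r (INR (S c))) in Hn; [| exact Hc].
    rewrite Rinv_l in Hn by lra. lra.
Qed.

(** * Rationals in the forcing model *)

Lemma forces_grounded φ e q x :
  absolute φ ->
  near (fun y => forall n, feq (e n) (check (q n)) y) x ->
  forces φ e x <-> sat mem q φ.
Proof.
  intros H E. rewrite <- (H q x). split; apply forces_cong; [exact E |].
  revert E. apply near_mono. intros y K n. apply feq_sym, K.
Qed.

Lemma forces_is_fraction t a b c e x : forces (is_fraction t a b c) e x ->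
  exists m n k, feq (e a) (check (num m)) x /\ feq (e b) (check (num n)) x /\
    feq (e c) (check (num (S k))) x /\ feq (e t) (check (frac m n k)) x.
Proof.
  intros (Ha & Hb & Hc & Hc0 & p & Hp & Ht).
  apply forces_is_nat in Ha as [m Ha]. apply forces_is_nat in Hb as [n Hb].
  apply forces_is_nat in Hc as [[|k] Hc].
  - apply box_self in Hc0. destruct Hc0. now apply forces_is_empty.
  - rewrite forces_is_pair in Hp, Ht. simpl in Hp, Ht.
    exists m, n, k. refine (conj Ha (conj Hb (conj Hc _))).
    eapply feq_trans; [exact Ht |]. eapply feq_trans; [| apply feq_npair_check].
    apply feq_npair; [| exact Hc]. eapply feq_trans; [exact Hp |].
    eapply feq_trans; [| apply feq_npair_check]. now apply feq_npair.
Qed.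

Lemma forces_fraction_eq s t e a b c x : feq t (check (frac a b c)) x ->
  forces (fraction_eq 0 1) (s .: t .: e) x <-> fmem s (check (rational (val a b c))) x.
Proof.
  intros Ht.
  assert (K : forall u, feq s (check u) x ->
    forces (fraction_eq 0 1) (s .: t .: e) x <-> mem u (rational (val a b c))).
  { intros u Hu.
    (* The renaming fixes the two free variables and sends all others to 1. Every entry of the
       resulting assignment is then ground, as [forces_grounded] demands, although [e] is
       arbitrary. *)
    change (fraction_eq 0 1) with (ren (0 .: (fun _ => 1)) (fraction_eq 0 1)).
    rewrite forces_ren.
    rewrite (forces_grounded _ _ (u .: (fun _ => frac a b c))).
    - rewrite sat_fraction_eq, mem_rational. simpl. split.
      + intros (m & n & k & m' & n' & k' & -> & E & H).
        apply frac_inj in E as (-> & -> & ->). exists m, n, k. auto.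
      + intros (m & n & k & H & ->). exists m, n, k, a, b, c. auto.
    - apply absolute_compare_fractions, absolute_eq.
    - generalize (near_and _ _ _ (feq_near _ _ _ Hu) (feq_near _ _ _ Ht)).
      apply near_mono. intros y [H1 H2] [|n]; assumption. }
  rewrite fmem_check. split.
  - intros H. pose proof H as (u & v & w & u' & v' & w' & Hs & _).
    apply forces_is_fraction in Hs as (m & n & k & _ & _ & _ & Hs).
    exists (frac m n k). split; [now apply K | exact Hs].
  - intros (u & Hu & E). now apply (K u E).
Qed.

(** A forced rational is, on a neighbourhood, one fixed ground rational, because natural numbers
    already are. Clauses about rationals thus reduce to statements about real values [v]. *)
Lemma forces_is_rational q e x : forces (is_rational q) e x <->
  exists v, rational_value v /\ feq (e q) (check (rational v)) x.
Proof.
  assert (K : forall t a b c, feq t (check (frac a b c)) x ->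
    forces (All (0 ∈ 2 + q ⇔ fraction_eq 0 1)) (t .: e) x <->
    feq (e q) (check (rational (val a b c))) x).
  { intros t a b c Ht.
    apply (forces_comprehension (fraction_eq 0 1) (S q) (check (rational (val a b c))) (t .: e)).
    generalize (feq_near _ _ _ Ht). apply near_mono. intros y Hy. split.
    - intros s. now apply forces_fraction_eq.
    - intros z s. rewrite settle_scons, ev_check. apply forces_fraction_eq.
      apply feq_ev in Hy. rewrite Hy, ev_check. apply feq_refl. }
  unfold is_rational. split.
  - intros (t & (u & v & w & Ht) & Hq).
    apply forces_is_fraction in Ht as (a & b & c & _ & _ & _ & Ht).
    exists (val a b c). split; [now exists a, b, c |]. now apply (K t a b c Ht).
  - intros (v & (a & b & c & ->) & H). exists (check (frac a b c)).
    split; [| exact (proj2 (K _ _ _ _ (feq_refl _ _)) H)].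
    exists (check (num a)), (check (num b)), (check (num (S c))).
    assert (S : sat mem (num (S c) .: num b .: num a .: (fun _ => frac a b c)) (is_fraction 3 2 1 0)).
    { apply sat_is_fraction. exists a, b, c. auto. }
    apply (absolute_is_fraction 3 2 1 0 _ x) in S.
    change (is_fraction 3 2 1 0) with (ren (0 .: 1 .: 2 .: (fun _ => 3)) (is_fraction 3 2 1 0)).
    apply forces_ren. revert S. apply forces_cong, near_all.
    intros y [|[|[|[|n]]]]; apply feq_refl.
Qed.

Lemma forces_rational_lt p q e v w x :
  feq (e p) (check (rational v)) x -> feq (e q) (check (rational w)) x ->
  rational_value v -> rational_value w ->
  forces (rational_lt p q) e x <-> (v < w)%R.
Proof.
  intros Hp Hq Rv Rw.
  change (rational_lt p q) with (ren (p .: (fun _ => q)) (rational_lt 0 1)).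
  rewrite forces_ren. rewrite (forces_grounded _ _ (rational v .: (fun _ => rational w))).
  - now apply sat_rational_lt.
  - apply absolute_rational_lt.
  - generalize (near_and _ _ _ (feq_near _ _ _ Hp) (feq_near _ _ _ Hq)).
    apply near_mono. intros y [H1 H2] [|n]; assumption.
Qed.

(** * The generic real *)

Definition cut (r : R) : gset :=
  sup (fun p : {p | (triple_val p < r)%R} => rational (triple_val (proj1_sig p))).

Lemma mem_cut u r : mem u (cut r) <-> exists v, rational_value v /\ (v < r)%R /\ u = rational v.
Proof.
  unfold cut. rewrite mem_sup. split.
  - intros [[[[a b] c] H] ->]. eexists. split; [now exists a, b, c | split; [exact H | reflexivity]].
  - intros (v & (a & b & c & ->) & H & ->).
    now exists (exist (fun p => (triple_val p < r)%R) (a, b, c) H).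
Qed.

Lemma rational_mem_cut v r : rational_value v -> mem (rational v) (cut r) <-> (v < r)%R.
Proof.
  intros Rv. rewrite mem_cut. split; [| eauto].
  intros (w & _ & H & E). apply rational_inj in E; [now subst | exact Rv].
Qed.

Definition generic : name :=
  Nm (nat * nat * nat) (fun p => check (rational (triple_val p)))
    (fun p y => (triple_val p < y)%R) (fun _ => gempty).

Lemma near_gt v x : near (fun y => (v < y)%R) x <-> (v < x)%R.
Proof.
  split; [apply near_self |]. intros H. exists (x - v)%R. split; [lra |].
  intros y. unfold Rabs. destruct (Rcase_abs _); lra.
Qed.

Lemma near_lt v x : (x < v)%R -> near (fun y => (y < v)%R) x.
Proof.
  intros H. exists (v - x)%R. split; [lra |].
  intros y. unfold Rabs. destruct (Rcase_abs _); lra.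
Qed.

Lemma ev_generic x : ev generic x = cut x.
Proof.
  apply gset_ext. intros u. unfold generic. rewrite mem_ev, mem_cut. split.
  - intros [([[a b] c] & H & ->) | H]; [| now apply mem_gempty in H].
    apply near_gt in H. rewrite ev_check. eexists.
    split; [now exists a, b, c | split; [exact H | reflexivity]].
  - intros (v & (a & b & c & ->) & H & ->). left. exists (a, b, c).
    split; [now apply near_gt | now rewrite ev_check].
Qed.

Definition cut_at (S : name) (r x : R) : Prop :=
  forall s, fmem s S x <->
    exists v, rational_value v /\ (v < r)%R /\ feq s (check (rational v)) x.

Lemma cut_at_generic x : cut_at generic x x.
Proof.
  intros s. simpl. split.
  - intros ([[a b] c] & H & E). apply near_gt in H. eexists.
    split; [now exists a, b, c | split; [exact H | exact E]].
  - intros (v & (a & b & c & ->) & H & E). exists (a, b, c). split; [now apply near_gt | exact E].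
Qed.

Lemma cut_at_check r x : cut_at (check (cut r)) r x.
Proof.
  intros s. rewrite fmem_check. split.
  - intros (u & Hu & E). apply mem_cut in Hu as (v & Rv & H & ->). eauto.
  - intros (v & Rv & H & E). exists (rational v). split; [apply mem_cut; eauto | exact E].
Qed.

Lemma cut_at_rational S r x s v :
  cut_at S r x -> rational_value v -> feq s (check (rational v)) x -> fmem s S x <-> (v < r)%R.
Proof.
  intros HS Rv E. rewrite (HS s). split; [| eauto].
  intros (w & _ & H & F).
  assert (v = w) as <-; [| exact H]. apply rational_inj; [exact Rv |].
  apply (feq_check _ _ x). eapply feq_trans; [apply feq_sym, E | exact F].
Qed.

Definition dedekind_clauses (e : nat -> name) (x : R) : Prop :=
  (forall s, fmem s (e 0) x -> forces (is_rational 0) (s .: e) x) /\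
  forces (Ex (is_rational 0 ⊓ 0 ∈ 1) ⊓ Ex (is_rational 0 ⊓ Not (0 ∈ 1))) e x /\
  (forall s, fmem s (e 0) x -> forces (ExIn 1 (rational_lt 1 0)) (s .: e) x) /\
  (forall p q, forces (is_rational 1) (q .: p .: e) x -> forces (is_rational 0) (q .: p .: e) x ->
     forces (rational_lt 1 0) (q .: p .: e) x -> forces (1 ∈ 2 ⊔ Not (0 ∈ 2)) (q .: p .: e) x).

Lemma boxed_is_dedekind_real : boxed (is_dedekind_real 0) dedekind_clauses.
Proof.
  apply (boxed_and (AllIn 0 (is_rational 0))); [apply boxed_all_imp |].
  apply boxed_and; [apply boxed_forces |].
  apply boxed_and; [apply boxed_all_imp |].
  exact (boxed_all _ _ (boxed_all _ _ (boxed_imp _ _ _ (boxed_imp _ _ _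
    (boxed_imp _ _ _ (boxed_forces (1 ∈ 2 ⊔ Not (0 ∈ 2)))))))).
Qed.

(** [ρ] is the identity for [generic] and constant for a ground real, so that
    both the generic real and its settled values are covered. *)
Definition named_real (S : name) (ρ : R -> R) (x : R) : Prop :=
  near (fun y => cut_at S (ρ y) y /\ ev S y = cut (ρ y)) x /\
  forall v, (ρ x < v)%R -> near (fun y => (ρ y < v)%R) x.

(** Strictness of [ρ x < v] is essential: a negation must hold on a neighbourhood, and for the
    generic real [v = x] becomes a member immediately to the right of [x]. *)
Lemma forces_not_in_cut S ρ x e i j v :
  named_real S ρ x -> e i = S -> rational_value v -> feq (e j) (check (rational v)) x -> (ρ x < v)%R ->
  forces (Not (j ∈ i)) e x.
Proof.
  intros [HS Hρ] <- Rv E Hv. generalize (near_and3 _ _ _ _ HS (Hρ v Hv) (feq_near _ _ _ E)).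
  apply near_mono. intros y ((H & K) & L & F). split.
  - intros M. apply (cut_at_rational _ _ _ _ _ H Rv F) in M. lra.
  - intros z M. simpl in M. unfold settle in M. apply feq_ev in F. rewrite ev_check in F.
    rewrite K, F, fmem_check2, rational_mem_cut in M by exact Rv. lra.
Qed.

Lemma dedekind_clauses_cut S ρ x e : named_real S ρ x -> dedekind_clauses (S .: e) x.
Proof.
  intros HS. pose proof HS as [HS' _]. apply near_self in HS'. destruct HS' as [HSx _].
  split; [| split; [split | split]].
  - intros s Hs. apply HSx in Hs as (v & Rv & _ & E). apply forces_is_rational. eauto.
  - destruct (rational_value_dense (ρ x - 1) (ρ x)) as (v & Rv & H); [lra |].
    exists (check (rational v)). split.
    + apply forces_is_rational. exists v. split; [exact Rv | apply feq_refl].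
    + apply (cut_at_rational _ _ _ _ v HSx Rv); [apply feq_refl | lra].
  - destruct (rational_value_dense (ρ x) (ρ x + 1)) as (v & Rv & H); [lra |].
    exists (check (rational v)). split.
    + apply forces_is_rational. exists v. split; [exact Rv | apply feq_refl].
    + apply (forces_not_in_cut S ρ x _ _ _ v); [exact HS | reflexivity | exact Rv | apply feq_refl | lra].
  - intros s Hs. apply HSx in Hs as (v & Rv & Hv & E).
    destruct (rational_value_dense v (ρ x) Hv) as (w & Rw & H).
    exists (check (rational w)). split.
    + apply (cut_at_rational _ _ _ _ w HSx Rw); [apply feq_refl | lra].
    + apply (forces_rational_lt 1 0 _ v w); auto using feq_refl. lra.
  - intros p q Hp Hq Hlt. apply forces_is_rational in Hp as (v & Rv & E).
    apply forces_is_rational in Hq as (w & Rw & F).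
    rewrite (forces_rational_lt 1 0 _ v w) in Hlt by assumption.
    (* If [v < ρ x] fails, then [ρ x <= v < w] still leaves [w] strictly above [ρ x]. The gap in
       locatedness is what makes the negation forceable. *)
    destruct (Rlt_dec v (ρ x)).
    + left. now apply (cut_at_rational _ _ _ _ v HSx Rv).
    + right. apply (forces_not_in_cut S ρ x _ _ _ w); [exact HS | reflexivity | exact Rw | exact F | lra].
Qed.

Lemma forces_generic_dedekind e x : forces (is_dedekind_real 0) (generic .: e) x.
Proof.
  apply boxed_is_dedekind_real, near_all. intros y. split.
  - apply (dedekind_clauses_cut generic (fun y => y)). split; [| intros v; apply near_lt].
    apply near_all. auto using cut_at_generic, ev_generic.
  - intros z. rewrite settle_scons, ev_generic.
    apply (dedekind_clauses_cut _ (fun _ => y)). split.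
    + apply near_all. auto using cut_at_check, ev_check.
    + intros v Hv. now apply near_all.
Qed.

Theorem theorem1p2 :
  has_model ZF -> ~ provable CZF_Exp dedekind_reals_are_a_set.
Proof.
  intros _ (Γ & HΓ & D).
  destruct (soundness _ _ D (fun _ => check gempty) 0%R) as [Z HZ].
  { intros φ Hφ. now apply valid_CZF_Exp, HΓ. }
  apply (boxed_all_iff (0 ∈ 1) (is_dedekind_real 0)) in HZ.
  (* From here on [Z] is a ground set, yet the equivalence still applies to every name, in
     particular to [generic] at 0. *)
  apply box_settled with (z := 0%R) in HZ.
  destruct (HZ generic) as [_ H]. specialize (H (forces_generic_dedekind _ _)).
  apply fmem_check in H as (u & _ & E). apply feq_near in E as (d & Hd & E).
  (* The generic cut equals the ground set [u] on a whole interval, so all ordinary cuts there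
     coincide; a rational between 0 and [d / 2] separates two of them. *)
  assert (Eu : forall y, (Rabs (y - 0) < d)%R -> cut y = u).
  { intros y Hy. pose proof (feq_ev _ _ _ (E y Hy)) as K. now rewrite ev_generic, ev_check in K. }
  assert (L : cut 0 = cut (d / 2)).
  { rewrite !Eu; [reflexivity | | ]; unfold Rabs; destruct (Rcase_abs _); lra. }
  destruct (rational_value_dense 0 (d / 2)) as (v & Rv & Hv); [lra |].
  assert (K : mem (rational v) (cut (d / 2))) by (apply rational_mem_cut; [exact Rv | lra]).
  rewrite <- L, rational_mem_cut in K by exact Rv. lra.
Qed.
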